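(* Let $N\ge2$ and $A\in M_N(\{0,1\})$. (i) For $(J,z)\in\{1,\ldots,N\}^*_{A,c}\times U(1)$, $P(J;z)$ is irreducible if and only if $J$ is non periodic. Especially, for $J\in\{1,\ldots,N\}^*_{A,c}$, $P(J)$ is irreducible if and only if $J$ is non periodic. (ii) For $J,J'\in\{1,\ldots,N\}^*_{A,c}$ and $z,z'\in U(1)$, $P(J;z)\sim P(J';z')$ if and only if $(J,z)\sim(J',z')$. (iii) For $J\in\{1,\ldots,N\}^*_{A,c}$, $w\in U(1)$ and $p\ge1$, the decomposition $P(J^p;w)\sim\bigoplus_{j=1}^pP(J;w^{1/p}\xi^j)$, $\xi=e^{2\pi\sqrt{-1}/p}$, is multiplicity free when $J$ is non periodic.
   Context: $U(1)=\{z\in{\bf C}:|z|=1\}$ and $w^{1/p}$ is a $p$-th root of $w$. $M_N(\{0,1\})$ is the set of $N\times N$ matrices with entries in $\{0,1\}$ having no row or column identically equal to zero. For $A=(a_{ij})\in M_N(\{0,1\})$, the Cuntz-Krieger algebra ${\cal O}_A$ is the $C^*$-algebra universally generated by partial isometries $s_1,\ldots,s_N$ satisfying $s_i^*s_i=\sum_{j=1}^N a_{ij}s_js_j^*$ for $i=1,\ldots,N$ and $\sum_{i=1}^N s_is_i^*=I$. A representation is a unital $*$-representation on a complex Hilbert space; $\sim$ between representations denotes unitary equivalence. $\{1,\ldots,N\}^*_{A,c}$ is the set of finite words $(j_1,\ldots,j_k)$, $k\ge1$, in $\{1,\ldots,N\}$ with $a_{j_{i-1}j_i}=1$ for $i=2,\ldots,k$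 and $a_{j_kj_1}=1$. $J^p$ is the $p$-fold concatenation of $J$. $J$ is periodic if $J=J_0^m$ for some nonempty finite word $J_0$ and $m\ge2$. For finite words, $J\sim J'$ if they have the same length and $J'$ is a cyclic rotation of $J$; $(J,z)\sim(J',z')$ if $J\sim J'$ and $z=z'$. For a finite word $J=(j_l)_{l=1}^k$ and $z\in U(1)$, a representation $({\cal H},\pi)$ of ${\cal O}_A$ is $P(J;z)$ if there is a cyclic unit vector $\Omega\in{\cal H}$ such that $\pi(s_{j_1}\cdots s_{j_k})\Omega=z\Omega$ and $\{\pi(s_{j_l}\cdots s_{j_k})\Omega\}_{l=1}^k$ is an orthonormal family; $P(J)=P(J;1)$. For $J\in\{1,\ldots,N\}^*_{A,c}$ such a representation exists and is unique up to unitary equivalence, and the symbols also denote this equivalence class. *)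

(* Defs.v *)
From HB Require Import structures.
From mathcomp Require Import all_boot all_order all_algebra.
From mathcomp Require Import complex.
From mathcomp Require Import all_classical all_reals all_analysis.
From mathcomp Require Import ring.

Set Implicit Arguments.
Unset Strict Implicit.
Unset Printing Implicit Defensive.

Import Order.TTheory GRing.Theory Num.Theory.
Import numFieldNormedType.Exports.
Local Open Scope classical_set_scope.
Local Open Scope ring_scope.

(* Unital C*-algebras over the complex numbers R[i]; the norm `cnorm` takes its
   values in R and completeness is stated with Cauchy sequences. *)
HB.mixin Record isCStarAlgebra (R : realType) A of GRing.Algebra R[i] A := {
  star : A -> A;
  starD : forall x y, star (x + y) = star x + star y;
  starZ : forall (c : R[i]) x, star (c *: x) = c^* *: star x;
  starM : forall x y, star (x * y) = star y * star x;
  starK : forall x, star (star x) = x;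
  cnorm : A -> R;
  cnormD : forall x y, cnorm (x + y) <= cnorm x + cnorm y;
  cnormZ : forall (c : R[i]) x, (cnorm (c *: x))%:C%C = `|c| * (cnorm x)%:C%C;
  cnorm0_eq0 : forall x, cnorm x = 0 -> x = 0;
  cnormM : forall x y, cnorm (x * y) <= cnorm x * cnorm y;
  cnorm_star_mul : forall x, cnorm (star x * x) = cnorm x ^+ 2;
  cnorm_complete : forall u : nat -> A,
    (forall e : R, 0 < e -> exists n0 : nat, forall m n : nat,
      (n0 <= m)%N -> (n0 <= n)%N -> cnorm (u m - u n) < e) ->
    exists l : A, (fun n => cnorm (u n - l)) @ \oo --> (0 : R)
}.

#[short(type="cstarAlgType")]
HB.structure Definition CStarAlgebra (R : realType) :=
  {A of GRing.Algebra R[i] A & isCStarAlgebra R A}.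

(* The inner product is linear in its first argument and conjugate-linear in
   the second one. *)
HB.mixin Record isHilbert (R : realType) H of CompleteNormedModule R[i] H := {
  inner : {dot H for Num.conj};
  normr_inner : forall x : H, `|x| ^+ 2 = inner x x
}.

#[short(type="hilbertType")]
HB.structure Definition Hilbert (R : realType) :=
  {H of CompleteNormedModule R[i] H & isHilbert R H}.

Lemma dot_CauchySchwarz (C : numClosedFieldType) (U : lmodType C)
    (f : {dot U for Num.conj}) (u v : U) :
  `|f u v| ^+ 2 <= f u u * f v v.
Proof.
have [->|v0] := eqVneq v 0; first by rewrite linear0r normr0 expr0n/= linear0r mulr0.
have fv : 0 < f v v by rewrite dnorm_gt0.
have fvr : (f v v)^* = f v v by rewrite (CrealP _)// ger0_real// ltW.
have Zl c x y : f (c *: x) y = c * f x y by exact: linearZl_LR.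
have Zr c x y : f x (c *: y) = c^* * f x y by exact: linearZr_LR.
have := dnorm_ge0 f (f v v *: u - f u v *: v).
rewrite dnormB !Zl !Zr !rmorphM/= fvr normCK conjCK.
set a := f u u; set b := f u v; set d := f v v.
have -> : d * (d * a) + b * (b^* * d) - (d * (b^* * b) + d * (b * b^*)) =
   d * (a * d - b * b^*) by ring.
by rewrite pmulr_rge0// subr_ge0.
Qed.

(* The Hilbert direct sum of a finite family of Hilbert spaces: dependent
   functions, with the inner product \sum_i <x_i, y_i>. *)
Section DirectSumHilbert.
Context (R : realType) (I : finType) (H : I -> hilbertType R).

Definition hsum : Type := forall i, H i.

HB.instance Definition _ := gen_eqMixin hsum.
HB.instance Definition _ := gen_choiceMixin hsum.

Let add (x y : hsum) : hsum := fun i => x i + y i.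
Let zero : hsum := fun=> 0.
Let opp (x : hsum) : hsum := fun i => - x i.
Let scale (c : R[i]) (x : hsum) : hsum := fun i => c *: x i.

Let addA : associative add.
Proof. by move=> x y z; apply/functional_extensionality_dep=> i; exact: addrA. Qed.
Let addC : commutative add.
Proof. by move=> x y; apply/functional_extensionality_dep=> i; exact: addrC. Qed.
Let add0 : left_id zero add.
Proof. by move=> x; apply/functional_extensionality_dep=> i; exact: add0r. Qed.
Let addN : left_inverse zero opp add.
Proof. by move=> x; apply/functional_extensionality_dep=> i; exact: addNr. Qed.

HB.instance Definition _ := GRing.isZmodule.Build hsum addA addC add0 addN.

Let scaleA a b (x : hsum) : scale a (scale b x) = scale (a * b) x.
Proof. by apply/functional_extensionality_dep=> i; exact: scalerA. Qed.
Let scale1 : left_id 1 scale.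
Proof. by move=> x; apply/functional_extensionality_dep=> i; exact: scale1r. Qed.
Let scaleDr : right_distributive scale +%R.
Proof. by move=> a x y; apply/functional_extensionality_dep=> i; exact: scalerDr. Qed.
Let scaleDl (x : hsum) : {morph scale^~ x : a b / a + b}.
Proof. by move=> a b; apply/functional_extensionality_dep=> i; exact: scalerDl. Qed.

HB.instance Definition _ :=
  GRing.Zmodule_isLmodule.Build R[i] hsum scaleA scale1 scaleDr scaleDl.

Definition hsum_inner (x y : hsum) : R[i] := \sum_i inner (x i) (y i).

Lemma hsum_zmodl y : zmod_morphism (hsum_inner^~ y).
Proof.
by move=> x x'; rewrite /hsum_inner -sumrB; apply: eq_bigr => i _; rewrite -linearBl.
Qed.
Lemma hsum_zmodr x : zmod_morphism (hsum_inner x).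
Proof.
by move=> y y'; rewrite /hsum_inner -sumrB; apply: eq_bigr => i _; rewrite -linearBr.
Qed.
Lemma hsum_scalel y : scalable_for *%R (hsum_inner^~ y).
Proof.
by move=> c x; rewrite /hsum_inner mulr_sumr; apply: eq_bigr => i _; rewrite -linearZl_LR.
Qed.
Lemma hsum_scaler x : scalable_for (Num.conj \; *%R) (hsum_inner x).
Proof.
move=> c y; rewrite /hsum_inner /= mulr_sumr; apply: eq_bigr => i _; exact: (linearZr_LR (@inner R (H i))).
Qed.
Lemma hsum_herm x y : hsum_inner x y = (-1) ^+ false * (hsum_inner y x)^*.
Proof.
rewrite expr0 mul1r /hsum_inner rmorph_sum; apply: eq_bigr => i _.
by rewrite (hermC (@inner R (H i))) expr0 mul1r.
Qed.
Lemma hsum_pos x : x != 0 -> 0 < hsum_inner x x.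
Proof.
move=> x0; have [i xi] : exists i, x i != 0.
  apply: contrapT => h; move/eqP: x0; apply.
  apply/functional_extensionality_dep => i; apply/eqP/negPn/negP => xi.
  by apply: h; exists i.
rewrite /hsum_inner (bigD1 i)//= ltr_pwDl ?dnorm_gt0// sumr_ge0// => j _.
Qed.
HB.instance Definition _ := isBilinear.Build R[i] hsum hsum R[i] *%R (Num.conj \; *%R) hsum_inner
  hsum_zmodl hsum_zmodr hsum_scalel hsum_scaler.
HB.instance Definition _ := isHermitianSesquilinear.Build R[i] hsum false Num.conj hsum_inner hsum_herm.
HB.instance Definition _ := isDotProduct.Build R[i] hsum hsum_inner hsum_pos.

Definition hsum_norm (x : hsum) : R[i] := sqrtC (hsum_inner x x).

Lemma hsum_norm_ge0 x : 0 <= hsum_norm x.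
Proof. by rewrite sqrtC_ge0; exact: dnorm_ge0. Qed.
Lemma hsum_normD x y : hsum_norm (x + y) <= hsum_norm x + hsum_norm y.
Proof.
rewrite -(@ler_pXn2r _ 2)// ?nnegrE ?addr_ge0 ?hsum_norm_ge0//.
rewrite sqrrD !sqrtCK dnormD/= addrAC lerD2r// lerD2l//.
set d := hsum_inner x y.
have dr : d + d^* \is Num.real by rewrite CrealE rmorphD/= conjCK addrC.
apply: (le_trans (real_ler_norm dr)); apply: (le_trans (ler_normD _ _)).
rewrite norm_conjC -mulr2n lerMn2r/=.
rewrite -(@ler_pXn2r _ 2)// ?nnegrE ?mulr_ge0 ?hsum_norm_ge0//.
by rewrite exprMn !sqrtCK; exact: dot_CauchySchwarz.
Qed.
Lemma hsum_normZ (c : R[i]) x : hsum_norm (c *: x) = `|c| * hsum_norm x.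
Proof.
rewrite /hsum_norm (dnormZ hsum_inner) rootCMl ?exprn_ge0//.
by rewrite sqrCK.
Qed.
Lemma hsum_norm0 x : hsum_norm x = 0 -> x = 0.
Proof. by move/eqP; rewrite sqrtC_eq0 dnorm_eq0 => /eqP. Qed.

HB.instance Definition _ := Lmodule_isNormed.Build R[i] hsum hsum_normD hsum_normZ hsum_norm0.

Lemma hsum_norm_sq (x : hsum) : `|x| ^+ 2 = hsum_inner x x.
Proof. exact: sqrtCK. Qed.

Lemma hsum_proj_le i (x : hsum) : `|x i| <= `|x|.
Proof.
rewrite -(@ler_pXn2r _ 2)// ?nnegrE// hsum_norm_sq normr_inner.
rewrite /hsum_inner (bigD1 i)//= lerDl sumr_ge0// => j _; exact: dnorm_ge0.
Qed.

Lemma hsum_le_proj (x : hsum) : `|x| <= \sum_i `|x i|.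
Proof.
rewrite -(@ler_pXn2r _ 2)// ?nnegrE ?sumr_ge0// hsum_norm_sq expr2 mulr_sumr.
rewrite /hsum_inner; apply: ler_sum => i _; rewrite -normr_inner expr2.
by rewrite ler_wpM2r// (bigD1 i)//= lerDl sumr_ge0.
Qed.

Lemma hsum_complete (F : set_system hsum) : ProperFilter F -> cauchy F -> cvg F.
Proof.
move=> FF /cauchyP Fc.
have Fi i : cvg ((fun x : hsum => x i) @ F).
  apply: cauchy_cvg; apply/cauchyP => e e0.
  have [x Fx] := Fc e e0; exists (x i).
  change (F [set y : hsum | ball (x i) e (y i)]).
  apply: filterS Fx => y; rewrite -!ball_normE/= => h.
  by apply: le_lt_trans h; exact: (hsum_proj_le i (x - y)).
apply/cvg_ex; exists (fun i => lim ((fun x : hsum => x i) @ F)).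
apply/cvgrPdist_lt => e e0.
have d0 : 0 < e / #|I|.+1%:R by rewrite divr_gt0.
have : \forall x \near F, forall i, `|lim ((fun x : hsum => x i) @ F) - x i| < e / #|I|.+1%:R.
  by apply: filter_forall => i; exact: (cvgrPdist_lt _ _).1 (Fi i) _ d0.
apply: filterS => x xd; apply: le_lt_trans (hsum_le_proj _) _.
apply: (@le_lt_trans _ _ (\sum_(i : I) e / #|I|.+1%:R)).
  by apply: ler_sum => i _; exact: ltW (xd i).
rewrite sumr_const -[X in X < _]mulr_natr mulrAC ltr_pdivrMr//.
by rewrite ltr_pM2l// ltr_nat.
Qed.
HB.instance Definition _ := isPointed.Build hsum 0.
HB.instance Definition _ := Uniform_isComplete.Build hsum hsum_complete.
HB.instance Definition _ := isHilbert.Build R hsum hsum_norm_sq.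
End DirectSumHilbert.

Section Representations.
Context (R : realType) (O : cstarAlgType R).

Record representation := Representation {
  rep_space :> hilbertType R;
  rep_op : O -> rep_space -> rep_space;
  rep_linear : forall a, linear (rep_op a);
  rep_bounded : forall a, exists M : R[i], forall x, `|rep_op a x| <= M * `|x|;
  repD : forall a b x, rep_op (a + b) x = rep_op a x + rep_op b x;
  repZ : forall (c : R[i]) a x, rep_op (c *: a) x = c *: rep_op a x;
  rep1 : forall x, rep_op 1 x = x;
  repM : forall a b x, rep_op (a * b) x = rep_op a (rep_op b x);
  rep_star : forall a x y, inner (rep_op (star a) x) y = inner x (rep_op a y)
}.

Definition unitary_equiv (pi rho : representation) : Prop :=
  exists U : {linear pi -> rho},
    [/\ forall x y, inner (U x) (U y) = inner x y,
        forall y, exists x, U x = y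
      & forall a x, U (rep_op a x) = rep_op a (U x)].

Definition invariant_subspace (pi : representation) (K : set pi) : Prop :=
  [/\ K 0,
      forall (c : R[i]) x y, K x -> K y -> K (c *: x + y),
      closed K
    & forall a x, K x -> K (rep_op a x)].

Definition irreducible_rep (pi : representation) : Prop :=
  (exists x : pi, x != 0) /\
  forall K : set pi, invariant_subspace K -> K = [set 0] \/ K = setT.

Definition cyclic_vector (pi : representation) (Omega : pi) : Prop :=
  closure (range (fun a : O => rep_op a Omega)) = setT.

Section DirectSum.
Context (I : finType) (rho : I -> representation).
Local Notation H := (hsum (fun i => rep_space (rho i))).

Definition dsum_op (a : O) (x : H) : H := fun i => rep_op a (x i).

Lemma dsum_linear a : linear (dsum_op a).
Proof. by move=> c x y; apply/functional_extensionality_dep => i; exact: rep_linear. Qed.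

Lemma dsum_bounded a : exists M : R[i], forall x, `|dsum_op a x| <= M * `|x|.
Proof.
have [M Mb] := choice (fun i => rep_bounded (rho i) a).
exists (\sum_i `|M i|) => x.
apply: (le_trans (hsum_le_proj _)); rewrite mulr_suml; apply: ler_sum => i _.
apply: (le_trans (Mb i (x i))); apply: (@le_trans _ _ (`|M i| * `|x i|)).
  have [->|xi] := eqVneq (x i) 0; first by rewrite normr0 !mulr0.
  have xi0 : 0 < `|x i| by rewrite normr_gt0.
  rewrite ler_wpM2r//; apply: real_ler_norm.
  have Mx : 0 <= M i * `|x i| by apply: le_trans (Mb i (x i)).
  by rewrite ger0_real// -(pmulr_lge0 _ xi0).
by rewrite ler_wpM2l// hsum_proj_le.
Qed.

Lemma dsumD a b x : dsum_op (a + b) x = dsum_op a x + dsum_op b x.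
Proof. by apply/functional_extensionality_dep => i; exact: repD. Qed.

Lemma dsumZ (c : R[i]) a x : dsum_op (c *: a) x = c *: dsum_op a x.
Proof. by apply/functional_extensionality_dep => i; exact: repZ. Qed.

Lemma dsum1 x : dsum_op 1 x = x.
Proof. by apply/functional_extensionality_dep => i; exact: rep1. Qed.

Lemma dsumM a b x : dsum_op (a * b) x = dsum_op a (dsum_op b x).
Proof. by apply/functional_extensionality_dep => i; exact: repM. Qed.

Lemma dsum_star a x y :
  inner (dsum_op (star a) x : H) y = inner (x : H) (dsum_op a y).
Proof. by apply: eq_bigr => i _; exact: rep_star. Qed.

Definition direct_sum : representation :=
  @Representation H dsum_op dsum_linear dsum_bounded dsumD dsumZ dsum1 dsumM
    dsum_star.

Definition multiplicity_free : Prop :=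
  (forall i, irreducible_rep (rho i)) /\
  (forall i j, i != j -> ~ unitary_equiv (rho i) (rho j)).

End DirectSum.

End Representations.

Definition cstar_subalgebra (R : realType) (O : cstarAlgType R) (S : set O) :
    Prop :=
  [/\ S 0,
      forall (c : R[i]) a b, S a -> S b -> S (c *: a + b),
      forall a b, S a -> S b -> S (a * b),
      forall a, S a -> S (star a)
    & forall (u : nat -> O) (a : O), (forall n, S (u n)) ->
        (fun n => cnorm (u n - a)) @ \oo --> (0 : R) -> S a].

Section CuntzKrieger.
Context (N : nat) (A : 'M[bool]_N).

Definition no_zero_row_col : Prop :=
  (forall i, exists j, A i j) /\ (forall j, exists i, A i j).

Definition ck_family (R : realType) (O : cstarAlgType R) (s : 'I_N -> O) :
    Prop :=
  [/\ forall i, s i * star (s i) * s i = s i,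
      forall i, star (s i) * s i = \sum_j (A i j)%:R * (s j * star (s j))
    & \sum_i s i * star (s i) = 1].

(* (O, s) is the Cuntz-Krieger algebra of A: O is generated by s as a
   C*-algebra, and every other family satisfying the relations is the image of
   s under a unital *-homomorphism (necessarily unique). *)
Definition is_cuntz_krieger (R : realType) (O : cstarAlgType R)
    (s : 'I_N -> O) : Prop :=
  [/\ ck_family s,
      forall S : set O, cstar_subalgebra S -> (forall i, S (s i)) -> S = setT
    & forall (B : cstarAlgType R) (t : 'I_N -> B), ck_family t ->
        exists f : {lrmorphism O -> B},
          (forall a, f (star a) = star (f a)) /\ (forall i, f (s i) = t i)].

(* For J = j_1 ... j_k, path.cycle tests a_{j_{l-1} j_l} = 1 for 2 <= l <= k
   together with a_{j_k j_1} = 1. *)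
Definition cyclic_word (J : seq 'I_N) : Prop :=
  J != [::] /\ path.cycle (fun i j => A i j) J.

End CuntzKrieger.

Definition word_pow (T : Type) (J : seq T) (p : nat) : seq T :=
  flatten (nseq p J).

Definition periodic_word (T : Type) (J : seq T) : Prop :=
  exists (J0 : seq T) (m : nat),
    [/\ (0 < size J0)%N, (2 <= m)%N & J = word_pow J0 m].

Definition word_rotation (T : Type) (J J' : seq T) : Prop :=
  exists n : nat, J' = rot n J.

(* With J = j_1 ... j_k, `drop l J` is the suffix j_{l+1} ... j_k. *)
Definition is_P (R : realType) (O : cstarAlgType R) (N : nat) (s : 'I_N -> O)
    (J : seq 'I_N) (z : R[i]) (pi : representation O) : Prop :=
  exists Omega : pi,
    [/\ `|Omega| = 1,
        cyclic_vector Omega,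
        rep_op (\prod_(j <- J) s j) Omega = z *: Omega
      & forall l m : 'I_(size J),
          inner (rep_op (\prod_(j <- drop l J) s j) Omega)
                (rep_op (\prod_(j <- drop m J) s j) Omega) = (l == m)%:R].

(* e^(2 pi i / p) *)
Definition expi2pi_div (R : realType) (p : nat) : R[i] :=
  (cos (2 * pi / p%:R) +i* sin (2 * pi / p%:R))%C.

(* Main.v *)
Require Import Defs.
From HB Require Import structures.
From mathcomp Require Import all_boot all_order all_algebra.
From mathcomp Require Import complex.
From mathcomp Require Import all_classical all_reals all_analysis.
From mathcomp Require Import ring lra zify.

Set Implicit Arguments.
Unset Strict Implicit.
Unset Printing Implicit Defensive.

Import Order.TTheory GRing.Theory Num.Theory.
Import numFieldNormedType.Exports.
Local Open Scope classical_set_scope.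
Local Open Scope ring_scope.

(** Write Omega for the cyclic vector of P(J; z), k for the length of J and [h]
    for the periodic sequence of letters J J J ...  Reading J backwards from
    Omega, again and again, gives unit vectors f_0 = z Omega, f_1, f_2, ... with
    s_(h n) f_(n+1) = f_n and f_n = z f_(n+k) ([is_P_periodic_chain]).  In this
    form the phase disappears from the action of the generators, and the
    Cuntz-Krieger relations give s_i^* f_n = f_(n+1) if i = h n and 0 otherwise
    ([chain_adj]).  All the statements follow from the study of these chains.

    Uniqueness ([pchain_unitary]).  The Gram matrix of a chain depends only on k
    and z.  Given two chains f, f' for the same letters, the pairs
    (S_W f_n, S_W f'_n) in the direct sum are permuted up to scalars by the
    generators and their adjoints, and the form <x_1, y_1> - <x_2, y_2> vanishes
    between them.  So f_0 and f'_0 define the same state, and the uniqueness of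
    the GNS construction ([gns_unique]) gives a unitary intertwiner carrying f to
    f'.  Shifting a chain amounts to rotating its word, so rotations of J give
    equivalent representations.  If J is a proper power, its chain is also
    carried to a shift of itself by a unitary of the commutant, which has a finite
    order up to a scalar and is not scalar: its eigenspaces disprove
    irreducibility ([periodic_reducible]).

    Asymptotics ([word_adj_asymptotic]).  For every vector x the vectors S_W^* x
    approach the span of the chain when the word W gets long.  For aperiodic J
    and W a high power of J, the only surviving direction is that of Omega, so an
    invariant subspace contains Omega or is orthogonal to it
    ([aperiodic_irreducible]).  For an equivalence of P(J; z) with P(J'; z'), the
    transported chain of J satisfies y_n = (const) S_W^* y_n for arbitrarily long
    W, hence lies in the span of the chain of J'; comparing the two chains gives
    the equality of the lengths, of the phases, and of the words up to rotation
    ([pchain_equiv]).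

    Decomposition ([direct_sum_periodic_chain]).  For the p-th roots u_i of w, the
    normalized sum of the chains of the P(J; u_i) is a chain of length p k and
    phase w in the direct sum, its cyclicity being the invertibility of the
    Vandermonde matrix of the u_i; uniqueness then identifies the sum with
    P(J^p; w).

    Passing from the generators to the whole algebra uses that representations
    are norm continuous.  This is automatic; [rep_contractive] proves it without
    spectral theory, from the Neumann series and the C*-identity. *)

(** * Norms and inverses in a C*-algebra *)

Section CStarNorm.
Context (R : realType) (O : cstarAlgType R).
Implicit Types a b : O.

Lemma cnorm0 : cnorm (0 : O) = 0.
Proof.
by have := cnormZ (0 : R[i]) (0 : O); rewrite scale0r normr0 mul0r => -[].
Qed.

Lemma cnormN a : cnorm (- a) = cnorm a.
Proof.
by have := cnormZ (-1 : R[i]) a; rewrite scaleN1r normrN1 mul1r => -[].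
Qed.

Lemma cnorm_ge0 a : 0 <= cnorm a.
Proof.
by have := cnormD a (- a); rewrite subrr cnorm0 cnormN -mulr2n pmulrn_lge0.
Qed.

Lemma cnormZr (r : R) a : 0 <= r -> cnorm (r%:C%C *: a) = r * cnorm a.
Proof.
move=> r0; apply: (@complexI R); rewrite rmorphM/= cnormZ ger0_norm//.
by rewrite ler0c.
Qed.

Lemma cnorm_star a : cnorm (star a) = cnorm a.
Proof.
have le b : cnorm b <= cnorm (star b).
  have [->|b0] := eqVneq (cnorm b) 0; first exact: cnorm_ge0.
  have bp : 0 < cnorm b by rewrite lt0r b0 cnorm_ge0.
  by rewrite -(ler_pM2r bp) -expr2 -cnorm_star_mul cnormM.
by apply/eqP; rewrite eq_le le -{2}(starK a) le.
Qed.

Lemma cnormX a n : cnorm (a ^+ n) <= cnorm (1 : O) * cnorm a ^+ n.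
Proof.
elim: n => [|n IH]; first by rewrite !expr0 mulr1.
rewrite !exprSr mulrA; apply: le_trans (cnormM _ _) _.
by rewrite ler_wpM2r ?cnorm_ge0.
Qed.

Lemma cnormX_cvg a : cnorm a < 1 -> forall e : R, 0 < e ->
  exists n0, forall n, (n0 <= n)%N -> cnorm (1 : O) * cnorm a ^+ n < e.
Proof.
move=> a1 e e0; have := @cvg_geometric R (cnorm (1 : O)) (cnorm a).
rewrite ger0_norm ?cnorm_ge0// => /(_ a1) /cvgrPdist_lt /(_ _ e0)[n0 _ h].
exists n0 => n /h; rewrite sub0r normrN ger0_norm//.
by rewrite mulr_ge0 ?exprn_ge0// cnorm_ge0.
Qed.

Lemma neumann_series a : cnorm a < 1 -> exists b, b * (1 - a) = 1.
Proof.
move=> a1; pose u n : O := \sum_(i < n) a ^+ i.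
have a1' : 0 < 1 - cnorm a by rewrite subr_gt0.
have uS n : u n.+1 = u n + a ^+ n by rewrite /u big_ord_recr.
have ua n : u n * (1 - a) = 1 - a ^+ n.
  elim: n => [|n IH]; first by rewrite /u big_ord0 mul0r expr0 subrr.
  by rewrite uS mulrDl IH mulrBr mulr1 -exprSr addrA subrK.
pose C := cnorm (1 : O); have C0 : 0 <= C by exact: cnorm_ge0.
have remainder n d : (1 - cnorm a) * cnorm (u (n + d)%N - u n) <=
    C * cnorm a ^+ n - C * cnorm a ^+ (n + d).
  elim: d => [|d IH]; first by rewrite addn0 !subrr cnorm0 mulr0.
  rewrite addnS uS addrAC.
  apply: (@le_trans _ _ ((1 - cnorm a) *
      (cnorm (u (n + d)%N - u n) + cnorm (a ^+ (n + d))))).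
    by rewrite ler_wpM2l ?cnormD// ltW.
  have := cnormX a (n + d); rewrite -(ler_pM2l a1') => h.
  rewrite mulrDr; apply: le_trans (lerD IH h) _.
  by rewrite exprS le_eqVlt; apply/orP; left; apply/eqP; rewrite -/C; ring.
have [e e0|l ul] := @cnorm_complete R O u.
  have [n0 h] := cnormX_cvg a1 (mulr_gt0 a1' e0); exists n0.
  have main m n : (n0 <= n)%N -> (n <= m)%N -> cnorm (u m - u n) < e.
    move=> n0n /subnKC <-; rewrite -(ltr_pM2l a1').
    apply: le_lt_trans (remainder _ _) _; apply: le_lt_trans (h _ n0n).
    by rewrite gerBl mulr_ge0 ?exprn_ge0// cnorm_ge0.
  move=> m n n0m n0n; have [mn|/ltnW nm] := leqP m n; last exact: main.
  by rewrite -cnormN opprB; apply: main.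
exists l; apply/eqP; rewrite -subr_eq0; apply/eqP/cnorm0_eq0.
apply/eqP; rewrite eq_le cnorm_ge0 andbT; apply/ler_addgt0Pr => e e0.
rewrite add0r.
have e20 : 0 < e / 2 by rewrite divr_gt0.
pose D := cnorm (1 - a) + 1.
have D0 : 0 < D by rewrite ltr_wpDl// cnorm_ge0.
have [n0 h] := cnormX_cvg a1 e20.
move/cvgrPdist_lt : ul => /(_ _ (divr_gt0 e20 D0)) [n1 _ h'].
pose n := maxn n0 n1.
have hn : C * cnorm a ^+ n < e / 2 by apply: h; rewrite leq_maxl.
have hn' : cnorm (u n - l) < e / 2 / D.
  have := h' n; rewrite /= leq_maxr => /(_ isT).
  by rewrite sub0r normrN ger0_norm// cnorm_ge0.
have -> : l * (1 - a) - 1 = - ((u n - l) * (1 - a) + a ^+ n).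
  by rewrite mulrBl ua addrAC subrK opprB.
rewrite cnormN; apply: le_trans (cnormD _ _) _.
rewrite (splitr e); apply: lerD; last by apply: le_trans (cnormX a n) (ltW hn).
apply: le_trans (cnormM _ _) _.
move: hn'; rewrite ltr_pdivlMr// => /ltW; apply: le_trans.
by rewrite ler_wpM2l ?cnorm_ge0// lerDl.
Qed.

End CStarNorm.

(** * Hilbert spaces and the continuity of representations *)

Section HilbertBasics.
Context (R : realType) (H : hilbertType R).
Implicit Types x y : H.

Lemma innerDl x y w : inner (x + y) w = inner x w + inner y w.
Proof. exact: linearDl. Qed.
Lemma innerZl (c : R[i]) x w : inner (c *: x) w = c * inner x w.
Proof. exact: linearZl_LR. Qed.
Lemma innerZr (c : R[i]) x w : inner w (c *: x) = c^* * inner w x.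
Proof. exact: (linearZr_LR (@inner R H)). Qed.
Lemma inner0l x : inner 0 x = 0.
Proof. exact: linear0l. Qed.
Lemma innerBl x y w : inner (x - y) w = inner x w - inner y w.
Proof. exact: linearBl. Qed.
Lemma innerBr x y w : inner w (x - y) = inner w x - inner w y.
Proof. exact: linearBr. Qed.
Lemma inner_suml (I : Type) (r : seq I) (P : pred I) (F : I -> H) w :
  inner (\sum_(i <- r | P i) F i) w = \sum_(i <- r | P i) inner (F i) w.
Proof. exact: linear_sumlz. Qed.
Lemma inner_sumr (I : Type) (r : seq I) (P : pred I) (F : I -> H) w :
  inner w (\sum_(i <- r | P i) F i) = \sum_(i <- r | P i) inner w (F i).
Proof. exact: linear_sumr. Qed.

Lemma normr_inner_le x y : `|inner x y| <= `|x| * `|y|.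
Proof.
rewrite -(@ler_pXn2r _ 2)// ?nnegrE ?mulr_ge0// exprMn !normr_inner.
exact: dot_CauchySchwarz.
Qed.

(** The norm as an element of [R], where [lra] and infima are available. *)
Definition rnorm x : R := complex.Re `|x|.

Lemma rnormE x : `|x| = (rnorm x)%:C%C.
Proof. by rewrite RRe_real// normr_real. Qed.

Lemma rnorm_ge0 x : 0 <= rnorm x.
Proof. by rewrite -ler0c -rnormE. Qed.

Lemma rnorm_sq x : inner x x = (rnorm x ^+ 2)%:C%C.
Proof. by rewrite -normr_inner rnormE rmorphXn. Qed.

End HilbertBasics.

Section RepresentationBasics.
Context (R : realType) (O : cstarAlgType R) (pi : representation O).
Implicit Types (a b : O) (x y : pi).

Lemma op_lin a (c : R[i]) x y : rep_op a (c *: x + y) = c *: rep_op a x + rep_op a y.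
Proof. exact: rep_linear. Qed.
Lemma op_D a x y : rep_op a (x + y) = rep_op a x + rep_op a y.
Proof. by rewrite -[x]scale1r op_lin !scale1r. Qed.
Lemma op_0 a : rep_op a (0 : pi) = 0.
Proof. by apply: (addIr (rep_op a 0)); rewrite -op_D !add0r. Qed.
Lemma op_Z a (c : R[i]) x : rep_op a (c *: x) = c *: rep_op a x.
Proof. by rewrite -[c *: x]addr0 op_lin op_0 addr0. Qed.
Lemma op_N a x : rep_op a (- x) = - rep_op a x.
Proof. by rewrite -scaleN1r op_Z scaleN1r. Qed.
Lemma op_B a x y : rep_op a (x - y) = rep_op a x - rep_op a y.
Proof. by rewrite op_D op_N. Qed.
Lemma op_sum a (I : Type) (r : seq I) (P : pred I) (F : I -> pi) :
  rep_op a (\sum_(i <- r | P i) F i) = \sum_(i <- r | P i) rep_op a (F i).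
Proof. by apply: big_morph; [exact: op_D|exact: op_0]. Qed.
Lemma op0 x : rep_op (0 : O) x = 0.
Proof. by rewrite -(scale0r (0 : O)) repZ scale0r. Qed.
Lemma opB a b x : rep_op (a - b) x = rep_op a x - rep_op b x.
Proof. by rewrite repD -scaleN1r repZ scaleN1r. Qed.
Lemma opsum (I : Type) (r : seq I) (P : pred I) (F : I -> O) x :
  rep_op (\sum_(i <- r | P i) F i) x = \sum_(i <- r | P i) rep_op (F i) x.
Proof. by apply: (big_morph (fun a => rep_op a x)) => [a b|]; rewrite ?repD ?op0. Qed.

Lemma op_star_r a x y : inner (rep_op a x) y = inner x (rep_op (star a) y).
Proof. by rewrite -rep_star starK. Qed.

Lemma op_bounded a : exists2 M : R, 0 <= M & forall x, rnorm (rep_op a x) <= M * rnorm x.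
Proof.
have [M Mb] := rep_bounded pi a.
exists `|complex.Re M| => // x; rewrite -lecR rmorphM/= -!rnormE.
have [->|x0] := eqVneq x 0; first by rewrite op_0 !normr0 mulr0.
have xp : 0 < `|x| by rewrite normr_gt0.
have M0 : 0 <= M by rewrite -(pmulr_lge0 _ xp) (le_trans _ (Mb x)).
have ReM : (complex.Re M)%:C%C = M by rewrite RRe_real// ger0_real.
by rewrite ger0_norm -?ler0c ReM.
Qed.

(** The infimum [m] of the bounds of [T = pi(h)] is again a bound.  If
    [m > ||h||], then [1 - h^2 / m^2] is invertible by the Neumann series, so
    [1 - T^2 / m^2] is bounded below by some [1 / K]; expanding the square of
    its norm gives [|T x|^2 <= m^2 (1 - K^-2) |x|^2], against the choice of
    [m]. *)
Lemma selfadjoint_contractive h : star h = h ->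
  forall x, rnorm (rep_op h x) <= cnorm h * rnorm x.
Proof.
move=> hh; pose T : pi -> pi := rep_op h.
pose E := [set m : R | 0 <= m /\ forall x, rnorm (T x) <= m * rnorm x].
have lbE : has_lbound E by exists 0 => m [].
have E0 : E !=set0 by have [M M0 Mb] := op_bounded h; exists M.
pose m := inf E.
have m0 : 0 <= m by apply: lb_le_inf => // ? [].
have mE x : rnorm (T x) <= m * rnorm x.
  have [x0|x0] := eqVneq (rnorm x) 0.
    by have [M [_ Mb]] := E0; rewrite x0 mulr0; have := Mb x; rewrite x0 mulr0.
  have xp : 0 < rnorm x by rewrite lt0r x0 rnorm_ge0.
  rewrite -ler_pdivrMr//; apply: lb_le_inf => // M [_ Mb].
  by rewrite ler_pdivrMr.
suff mh : m <= cnorm h.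
  by move=> x; apply: le_trans (mE x) _; rewrite ler_wpM2r ?rnorm_ge0.
rewrite leNgt; apply/negP => hm.
have mp : 0 < m by apply: le_lt_trans hm; exact: cnorm_ge0.
pose q := m^-1 ^+ 2; have q0 : 0 <= q by rewrite exprn_ge0// invr_ge0.
have qm : q * m ^+ 2 = 1 by rewrite -exprMn mulVf ?expr1n// gt_eqF.
have [|b bE] := @neumann_series R O (q%:C%C *: h ^+ 2).
  rewrite cnormZr// -[h ^+ 2]/(h * h) -{1}hh cnorm_star_mul -qm.
  by rewrite ltr_pM2l ?exprn_gt0 ?invr_gt0// ltr_pXn2r// nnegrE cnorm_ge0.
have [K0 K00 K0b] := op_bounded b.
pose K := K0 + 1; have K1 : 1 <= K by rewrite lerDr.
have Kp : 0 < K by apply: lt_le_trans K1.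
have key x : rnorm (T x) ^+ 2 <= m ^+ 2 * (1 - K^-1 ^+ 2) * rnorm x ^+ 2.
  pose y := x - q%:C%C *: T (T x).
  have xy : rnorm x <= K * rnorm y.
    have -> : x = rep_op b y.
      rewrite -[LHS](rep1 x) -bE repM opB rep1 repZ -[h ^+ 2]/(h * h) repM.
      by [].
    by apply: le_trans (K0b y) _; rewrite ler_wpM2r ?rnorm_ge0// lerDl.
  have yE : rnorm y ^+ 2 =
      rnorm x ^+ 2 - 2 * q * rnorm (T x) ^+ 2 + q ^+ 2 * rnorm (T (T x)) ^+ 2.
    apply: (@complexI R); rewrite -rnorm_sq /y innerBl !innerBr innerZr !innerZl.
    rewrite innerZr.
    have -> : inner (T (T x)) x = inner (T x) (T x) by rewrite op_star_r hh.
    have -> : inner x (T (T x)) = inner (T x) (T x) by rewrite -rep_star hh.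
    have -> : (q%:C%C)^* = q%:C%C by rewrite (CrealP _)// complex_real.
    by rewrite !rnorm_sq !(rmorphD, rmorphN, rmorphM, rmorphXn)/=; ring.
  have ty := mE (T x).
  have ty2 : rnorm (T (T x)) ^+ 2 <= m ^+ 2 * rnorm (T x) ^+ 2.
    by rewrite -exprMn ler_pXn2r// nnegrE ?mulr_ge0 ?rnorm_ge0.
  have xy2 : rnorm x ^+ 2 <= K ^+ 2 * rnorm y ^+ 2.
    by rewrite -exprMn ler_pXn2r// nnegrE ?mulr_ge0 ?rnorm_ge0// ltW.
  have yle : rnorm y ^+ 2 <= rnorm x ^+ 2 - q * rnorm (T x) ^+ 2.
    rewrite yE; have := ler_wpM2l (exprn_ge0 2 q0) ty2.
    have -> : q ^+ 2 * (m ^+ 2 * rnorm (T x) ^+ 2) = q * rnorm (T x) ^+ 2.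
      by rewrite expr2 mulrACA qm mul1r.
    lra.
  have : K^-1 ^+ 2 * rnorm x ^+ 2 <= rnorm x ^+ 2 - q * rnorm (T x) ^+ 2.
    apply: le_trans yle; rewrite exprVn mulrC ler_pdivrMr ?exprn_gt0//.
    by rewrite mulrC.
  move=> h1; rewrite -mulrA.
  have {}h1 : q * rnorm (T x) ^+ 2 <= (1 - K^-1 ^+ 2) * rnorm x ^+ 2 by lra.
  have := ler_wpM2l (exprn_ge0 2 m0) h1.
  by rewrite (mulrCA (m ^+ 2) q) (mulrA q) qm mul1r.
have t1 : 1 - K^-1 ^+ 2 < 1 by rewrite gtrBl exprn_gt0// invr_gt0.
have t0 : 0 <= 1 - K^-1 ^+ 2.
  by rewrite subr_ge0 expr_le1// ?invr_ge0 ?invf_le1// ltW.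
have sE : E (m * Num.sqrt (1 - K^-1 ^+ 2)).
  split=> [|x]; first by rewrite mulr_ge0// sqrtr_ge0.
  rewrite -(@ler_pXn2r _ 2)// ?nnegrE ?mulr_ge0 ?sqrtr_ge0 ?rnorm_ge0//.
  by rewrite !exprMn sqr_sqrtr//; exact: key.
have := ge_inf lbE sE; rewrite -/m leNgt => /negP; apply.
rewrite gtr_pMr// -[ltRHS]sqrtr1.
by rewrite ltr_sqrt.
Qed.

Lemma rep_contractive a x : rnorm (rep_op a x) <= cnorm a * rnorm x.
Proof.
have sa : star (star a * a) = star a * a by rewrite starM starK.
have h := selfadjoint_contractive sa x.
rewrite -(@ler_pXn2r _ 2)// ?nnegrE ?mulr_ge0 ?rnorm_ge0 ?cnorm_ge0//.
rewrite -lecR -rnorm_sq -rep_star -repM.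
apply: (@le_trans _ _ (`|rep_op (star a * a) x| * `|x|)).
  apply: le_trans (normr_inner_le _ _); apply: real_ler_norm.
  by rewrite repM rep_star; apply: ger0_real; exact: dnorm_ge0.
rewrite !rnormE -rmorphM lecR exprMn -cnorm_star_mul (expr2 (rnorm x)) mulrA.
by rewrite ler_wpM2r// rnorm_ge0.
Qed.

End RepresentationBasics.

(** * Closed invariant subspaces *)

Section ClosedSubspaces.
Context (R : realType) (H : hilbertType R).
Implicit Types (x y : H) (K : set H).

Lemma closure_approx K x :
  closure K x <-> forall e : R[i], 0 < e -> exists2 y, K y & `|x - y| < e.
Proof.
split=> [Kx e e0|h B /nbhs_ballP[e /= e0 eB]].
  have [y [Ky xy]] := Kx (ball x e) (nbhsx_ballx x e e0).
  by exists y => //; move: xy; rewrite -ball_normE.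
have [y Ky xy] := h e e0; exists y; split=> //; apply: eB.
by rewrite -ball_normE.
Qed.

Lemma closed_approx K :
  (forall x, (forall e : R[i], 0 < e -> exists2 y, K y & `|x - y| < e) -> K x) ->
  closed K.
Proof.
move=> h; apply/closure_id/seteqP; split; first exact: subset_closure.
by move=> x /closure_approx; exact: h.
Qed.

Lemma closed_mem K x : closed K ->
  (forall e : R[i], 0 < e -> exists2 y, K y & `|x - y| < e) -> K x.
Proof. by move=> /closure_id Kc h; rewrite Kc; apply/closure_approx. Qed.

Definition subspace K :=
  K 0 /\ forall (c : R[i]) x y, K x -> K y -> K (c *: x + y).

Lemma subspaceD K x y : subspace K -> K x -> K y -> K (x + y).
Proof. by move=> [_ h] Kx Ky; rewrite -[x]scale1r; apply: h. Qed.
Lemma subspaceZ K (c : R[i]) x : subspace K -> K x -> K (c *: x).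
Proof. by move=> [K0 h] Kx; rewrite -[_ *: _]addr0; apply: h. Qed.
Lemma subspace_sum K (I : Type) (r : seq I) (P : pred I) (F : I -> H) :
  subspace K -> (forall i, P i -> K (F i)) -> K (\sum_(i <- r | P i) F i).
Proof.
by move=> h KF; apply: (big_ind K) => [|x y|i /KF//]; [case: h|exact: subspaceD].
Qed.

End ClosedSubspaces.

Section Generation.
Context (R : realType) (O : cstarAlgType R) (pi : representation O).

(** The elements of [O] whose image, together with that of their adjoint,
    preserves a closed subspace form a C*-subalgebra; norm closedness is where
    contractivity of the representation enters. *)
Lemma invariant_subspace_gen (I : Type) (s : I -> O) (K : set pi) :
  (forall S : set O, cstar_subalgebra S -> (forall i, S (s i)) -> S = setT) ->
  subspace K -> closed K ->
  (forall i x, K x -> K (rep_op (s i) x)) ->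
  (forall i x, K x -> K (rep_op (star (s i)) x)) ->
  invariant_subspace K.
Proof.
move=> gen [K0 Kl] Kc Ks Kss; split=> //.
pose S := [set a : O | (forall x, K x -> K (rep_op a x)) /\
                       (forall x, K x -> K (rep_op (star a) x))].
have ST : S = setT.
  apply: gen; last by move=> i; split; [exact: Ks|exact: Kss].
  split.
  - have s0 : star (0 : O) = 0.
      by rewrite -(scale0r (0 : O)) starZ rmorph0 !scale0r.
    by split=> x _; rewrite ?s0 op0; exact: K0.
  - move=> c a b [Sa Sa'] [Sb Sb']; split=> x Kx.
      by rewrite repD repZ; apply: Kl; [exact: Sa|exact: Sb].
    by rewrite starD starZ repD repZ; apply: Kl; [exact: Sa'|exact: Sb'].
  - move=> a b [Sa Sa'] [Sb Sb']; split=> x Kx; rewrite ?starM repM.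
      by apply: Sa; exact: Sb.
    by apply: Sb'; exact: Sa'.
  - by move=> a [Sa Sa']; split=> //; rewrite starK.
  - move=> u a Su ua.
    have lim (v : nat -> O) (b : O) x : (forall n, K (rep_op (v n) x)) ->
        (forall n, cnorm (v n - b) = cnorm (u n - a)) -> K (rep_op b x).
      move=> Kv vb; apply: closed_mem => // e e0.
      have er : e = (complex.Re e)%:C%C by rewrite RRe_real// gtr0_real.
      have r0 : 0 < complex.Re e by rewrite -ltcR -er.
      have x0 : 0 < rnorm x + 1 by rewrite ltr_wpDl// rnorm_ge0.
      move/cvgrPdist_lt: ua => /(_ _ (divr_gt0 r0 x0))[n _ /(_ n (leqnn n))].
      rewrite sub0r normrN ger0_norm ?cnorm_ge0// -vb => h.
      exists (rep_op (v n) x) => //; rewrite distrC -opB rnormE er ltcR.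
      apply: le_lt_trans (rep_contractive _ _) _.
      move: h; rewrite ltr_pdivlMr//; apply: le_lt_trans.
      by rewrite ler_wpM2l ?cnorm_ge0// lerDl.
    split=> x Kx; first by apply: (lim u) => // n; apply: (Su n).1.
    apply: (lim (fun n => star (u n))) => n; first exact: (Su n).2.
    by rewrite -scaleN1r -(rmorphN1 Num.conj) -starZ -starD scaleN1r cnorm_star.
move=> a x Kx; have [Sa _] : S a by rewrite ST.
exact: Sa.
Qed.

Lemma cyclic_vector_full (x0 : pi) (K : set pi) : cyclic_vector x0 ->
  invariant_subspace K -> K x0 -> K = setT.
Proof.
move=> cyc [_ _ Kc Ki] K0; apply/seteqP; split=> // x _.
have : closure (range (fun a : O => rep_op a x0)) x by rewrite cyc.
move=> /closure_approx h; apply: closed_mem => // e /h [y [a _ <-] xy].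
by exists (rep_op a x0) => //; exact: Ki.
Qed.

(** The cyclic subspace of [x0] is itself closed and invariant. *)
Lemma full_cyclic_vector (x0 : pi) :
  (forall K : set pi, invariant_subspace K -> K x0 -> K = setT) -> cyclic_vector x0.
Proof.
move=> h; apply: h; last first.
  by apply: subset_closure; exists 1 => //; rewrite rep1.
split.
- by apply: subset_closure; exists 0 => //; rewrite op0.
- move=> c x y /closure_approx hx /closure_approx hy; apply/closure_approx => e e0.
  have e20 : 0 < e / 2 by rewrite divr_gt0.
  have c0 : 0 < `|c| + 1 by rewrite ltr_wpDl.
  have [_ [a _ <-] xa] := hx _ (divr_gt0 e20 c0).
  have [_ [b _ <-] yb] := hy _ e20.
  exists (rep_op (c *: a + b) x0); first by exists (c *: a + b).
  rewrite repD repZ opprD addrACA -scalerBr (splitr e).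
  apply: le_lt_trans (ler_normD _ _) (ler_ltD _ yb).
  rewrite normrZ; move: xa; rewrite ltr_pdivlMr// => /ltW; apply: le_trans.
  by rewrite mulrC ler_wpM2l// lerDl.
- exact: closed_closure.
- move=> a x /closure_approx hx; apply/closure_approx => e e0.
  have [M M0 Mb] := op_bounded pi a.
  have M1 : 0 < (M + 1)%:C%C :> R[i] by rewrite ltcR ltr_wpDl.
  have [_ [b _ <-] xb] := hx _ (divr_gt0 e0 M1).
  exists (rep_op (a * b) x0); first by exists (a * b).
  rewrite repM -op_B; move: xb; rewrite ltr_pdivlMr//; apply: le_lt_trans.
  rewrite !rnormE -rmorphM lecR; apply: le_trans (Mb _) _.
  by rewrite mulrC ler_wpM2l ?rnorm_ge0// lerDl.
Qed.

End Generation.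

(** * Cuntz-Krieger relations and chains of vectors *)

Section CuntzKriegerRelations.
Context (R : realType) (N : nat) (A : 'M[bool]_N) (O : cstarAlgType R).
Context (s : 'I_N -> O) (ck : ck_family A s) (pi : representation O).
Implicit Types (i j : 'I_N) (x y : pi) (W : seq 'I_N).

Local Notation S i x := (rep_op (s i) x).
Local Notation Sa i x := (rep_op (star (s i)) x).

Lemma ck_partial_isometry i x : S i (Sa i (S i x)) = S i x.
Proof. by rewrite -!repM; case: ck => ->. Qed.

Lemma ck_resolution x : \sum_i S i (Sa i x) = x.
Proof.
case: ck => _ _ e; rewrite -[RHS](rep1 x) -e opsum.
by apply: eq_bigr => i _; rewrite repM.
Qed.

Lemma ck_adj_norm x : \sum_i `|Sa i x| ^+ 2 = `|x| ^+ 2.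
Proof.
rewrite normr_inner -{3}(ck_resolution x) inner_sumr; apply: eq_bigr => i _.
by rewrite normr_inner rep_star.
Qed.

Lemma ck_adj_contract i x : `|Sa i x| <= `|x|.
Proof.
rewrite -(@ler_pXn2r _ 2)// ?nnegrE// -(ck_adj_norm x) (bigD1 i)//= lerDl.
by apply: sumr_ge0 => j _; rewrite exprn_ge0.
Qed.

(** The range projections add up to the identity, so a vector in the range of
    [s j] has no square norm left for the components [i != j]. *)
Lemma ck_orthogonal i j x : i != j -> Sa i (S j x) = 0.
Proof.
move=> ij; have := ck_adj_norm (S j x).
have jE : `|Sa j (S j x)| ^+ 2 = `|S j x| ^+ 2.
  by rewrite !normr_inner rep_star ck_partial_isometry.
rewrite (bigD1 j)//= jE -[RHS]addr0 => /addrI /eqP.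
rewrite psumr_eq0 => [/allP h|? _]; last by rewrite exprn_ge0.
by have := h i (mem_index_enum _); rewrite ij /= expf_eq0 /= normr_eq0 => /eqP.
Qed.

Lemma ck_adj_op i j x : Sa i (S j x) = (i == j)%:R *: Sa i (S i x).
Proof.
by case: eqVneq => [->|ij]; rewrite ?scale1r// scale0r ck_orthogonal.
Qed.

Lemma ck_initial i j x : Sa i (S i (S j x)) = (A i j)%:R *: S j x.
Proof.
rewrite -!repM; case: ck => _ -> _.
rewrite repM opsum (bigD1 j)//= big1 ?addr0 => [|l lj].
  by case: (A i j); rewrite ?mul1r ?mul0r ?op0 ?scale0r// scale1r repM ck_partial_isometry.
case: (A i l); rewrite ?mul0r ?op0// mul1r repM ck_orthogonal ?op_0//.
Qed.

(** The adjoint form of [ck_initial], obtained by pairing the difference of the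
    two sides with itself. *)
Lemma ck_adj_initial i j x : Sa j (Sa i (S i x)) = (A i j)%:R *: Sa j x.
Proof.
apply/eqP; rewrite -subr_eq0 -(dnorm_eq0 (@inner R pi)); apply/eqP.
set y := _ - _; rewrite {1}/y innerBl innerZl !rep_star op_star_r.
by rewrite ck_initial innerZr conjC_nat subrr.
Qed.

Definition word_op W x := rep_op (\prod_(j <- W) s j) x.
Definition word_adj W x := rep_op (star (\prod_(j <- W) s j)) x.

Lemma star1 : star (1 : O) = 1.
Proof. by rewrite -[LHS]mulr1 -{2}(starK 1) -starM mulr1 starK. Qed.

Lemma word_op_nil x : word_op [::] x = x.
Proof. by rewrite /word_op big_nil rep1. Qed.
Lemma word_op_cons i W x : word_op (i :: W) x = S i (word_op W x).
Proof. by rewrite /word_op big_cons repM. Qed.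
Lemma word_adj_nil x : word_adj [::] x = x.
Proof. by rewrite /word_adj big_nil star1 rep1. Qed.
Lemma word_adj_cons i W x : word_adj (i :: W) x = word_adj W (Sa i x).
Proof. by rewrite /word_adj big_cons starM repM. Qed.
Lemma word_adjP W x y : inner (word_adj W x) y = inner x (word_op W y).
Proof. exact: rep_star. Qed.
Lemma word_adj_contract W x : `|word_adj W x| <= `|x|.
Proof.
elim: W x => [|i W IH] x; first by rewrite word_adj_nil.
by rewrite word_adj_cons; apply: le_trans (IH _) (ck_adj_contract i x).
Qed.

End CuntzKriegerRelations.

Section Chains.
Context (R : realType) (N : nat) (A : 'M[bool]_N) (O : cstarAlgType R).
Context (s : 'I_N -> O) (ck : ck_family A s) (pi : representation O).
Context (h : nat -> 'I_N) (hA : forall n, A (h n) (h n.+1)).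

(** Reading the letters backwards makes the adjoint generators act on [f] as a
    shift; see [chain_adj]. *)
Definition chain (h : nat -> 'I_N) (f : nat -> pi) :=
  forall n, rep_op (s (h n)) (f n.+1) = f n.

Definition segment (h : nat -> 'I_N) n m := [seq h l | l <- iota n m].

Lemma chain_adj f : chain h f -> forall n i,
  rep_op (star (s i)) (f n) = (i == h n)%:R *: f n.+1.
Proof.
move=> hf n i; rewrite -{1}(hf n) (ck_adj_op ck) -(hf n.+1).
case: eqVneq => [->|_]; last by rewrite !scale0r.
by rewrite (ck_initial ck) hA !scale1r.
Qed.

Lemma chain_op f : chain h f -> forall n m, word_op s (segment h n m) (f (n + m)%N) = f n.
Proof.
move=> hf n m; elim: m n => [|m IH] n; first by rewrite addn0 word_op_nil.
by rewrite word_op_cons -addSnnS IH hf.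
Qed.

Lemma chain_word_adj f : chain h f -> forall W n,
  word_adj s W (f n) = (W == segment h n (size W))%:R *: f (n + size W)%N.
Proof.
move=> hf W; elim: W => [|i W IH] n.
  by rewrite word_adj_nil eqxx scale1r addn0.
rewrite word_adj_cons (chain_adj hf) /word_adj op_Z -/(word_adj s W _) IH.
by rewrite scalerA /= eqseq_cons -natrM mulnb addSnnS.
Qed.

End Chains.

(** * Uniqueness of the GNS construction *)

Lemma real_eq0_approx (R : realType) (t : R[i]) :
  (forall e : R[i], 0 < e -> `|t| < e) -> t = 0.
Proof.
move=> h; apply/eqP/negPn/negP => t0.
by have := h `|t|; rewrite normr_gt0 ltxx => /(_ t0).
Qed.

Lemma archi_inv_lt (R : realType) (e : R[i]) : 0 < e ->
  exists n : nat, forall m, (n <= m)%N -> m.+1%:R^-1 < e.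
Proof.
move=> e0; have er : e = (complex.Re e)%:C%C by rewrite RRe_real// gtr0_real.
have r0 : 0 < complex.Re e by rewrite -ltcR -er.
exists (Num.bound (complex.Re e)^-1) => m nm.
have m0 : 0 < m.+1%:R :> R[i] by rewrite ltr0n.
rewrite -(ltr_pM2l m0) mulfV ?gt_eqF// er -(rmorph_nat (real_complex R)).
rewrite -rmorphM ltcR -ltr_pdivrMr// mul1r.
apply: lt_le_trans (archi_boundP _) _; first by rewrite invr_ge0 ltW.
by rewrite ler_nat leqW.
Qed.

(** Polarization: the squared norms of u + v and of 'i u + v determine <u, v>. *)
Lemma isometry_inner (R : realType) (H K : hilbertType R) (U : {linear H -> K}) :
  (forall x, `|U x| = `|x|) -> forall x y, inner (U x) (U y) = inner x y.
Proof.
move=> Un x y.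
have re u v : inner (U u) (U v) + (inner (U u) (U v))^* = inner u v + (inner u v)^*.
  have := Un (u + v) => /(congr1 (fun t => t ^+ 2)); rewrite !normr_inner linearD.
  rewrite (dnormD (@inner R K)) (dnormD (@inner R H)) -!normr_inner !Un.
  by move/addrI.
have h1 := re x y; have h2 := re ('i *: x) y.
move: h2; rewrite linearZ !innerZl !rmorphM/= conjCi !mulNr -!mulrBr.
move/(mulfI (neq0Ci _)) => h2.
have : inner (U x) (U y) *+ 2 = inner x y *+ 2.
  have dbl (t : R[i]) : t *+ 2 = (t + t^*) + (t - t^*) by rewrite addrACA subrr addr0 mulr2n.
  by rewrite dbl h1 h2 -dbl.
by move/eqP; rewrite -subr_eq0 -mulrnBl mulrn_eq0 /= subr_eq0 => /eqP.
Qed.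

Section GNS.
Context (R : realType) (O : cstarAlgType R).

(** The closure of the densely defined map pi(a) x0 |-> rho(a) y0. *)
Definition orbit_graph (pi rho : representation O) (x0 : pi) (y0 : rho) x y :=
  forall e : R[i], 0 < e -> exists a, `|x - rep_op a x0| < e /\ `|y - rep_op a y0| < e.

Lemma orbit_graph_sym (pi rho : representation O) (x0 : pi) (y0 : rho) x y :
  orbit_graph x0 y0 x y -> orbit_graph y0 x0 y x.
Proof. by move=> h e /h [a []]; exists a. Qed.

Definition same_state (pi rho : representation O) (x0 : pi) (y0 : rho) :=
  forall a, inner (rep_op a x0) x0 = inner (rep_op a y0) y0.

Lemma same_state_norm (pi rho : representation O) (x0 : pi) (y0 : rho) :
  same_state x0 y0 -> forall a, `|rep_op a x0| = `|rep_op a y0|.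
Proof.
move=> h a; apply/eqP; rewrite -(@eqrXn2 _ 2)// !normr_inner.
by rewrite -!rep_star -!repM h.
Qed.

(** The limit exists because the orbit of [y0] along a sequence approximating
    [x] is a Cauchy sequence, the two orbits being isometric. *)
Lemma orbit_graph_total (pi rho : representation O) (x0 : pi) (y0 : rho) :
  cyclic_vector x0 -> same_state x0 y0 -> forall x, exists y, orbit_graph x0 y0 x y.
Proof.
move=> cyc st x.
have approx n : exists a, `|x - rep_op a x0| < n.+1%:R^-1.
  have : closure (range (fun a : O => rep_op a x0)) x by rewrite cyc.
  move=> /closure_approx /(_ n.+1%:R^-1).
  by rewrite invr_gt0 ltr0n => /(_ isT) [_ [a _ <-] xa]; exists a.
have [a aP] := choice approx.
pose v n := rep_op (a n) y0.
have vc : cvg (v @ \oo).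
  apply: cauchy_cvg; apply/cauchyP => e e0.
  have [n nP] := archi_inv_lt (divr_gt0 e0 (ltr0n R[i] 2)).
  exists (v n); exists n => // m /= nm; rewrite -ball_normE/=.
  rewrite /v -opB -(same_state_norm st) opB.
  have -> : rep_op (a n) x0 - rep_op (a m) x0 =
      (x - rep_op (a m) x0) - (x - rep_op (a n) x0) by rewrite opprB [RHS]addrC addrA subrK.
  apply: le_lt_trans (ler_normB _ _) _; rewrite (splitr e); apply: ltrD.
    exact: lt_trans (aP m) (nP m nm).
  exact: lt_trans (aP n) (nP n (leqnn n)).
exists (lim (v @ \oo)) => e e0.
have [n nP] := archi_inv_lt e0.
move/cvgrPdist_lt: vc => /(_ e e0) [n' _ n'P].
exists (a (maxn n n')); split.
  by apply: lt_trans (aP _) (nP _ (leq_maxl _ _)).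
exact: (n'P (maxn n n') (leq_maxr _ _)).
Qed.

Lemma orbit_graph_norm (pi rho : representation O) (x0 : pi) (y0 : rho) :
  same_state x0 y0 -> forall x y, orbit_graph x0 y0 x y -> `|x| = `|y|.
Proof.
move=> st x y xy; apply/eqP; rewrite -subr_eq0; apply/eqP/real_eq0_approx => e e0.
have [a [xa ya]] := xy _ (divr_gt0 e0 (ltr0n R[i] 2)).
have -> : `|x| - `|y| =
   (`|x| - `|rep_op a x0|) - (`|y| - `|rep_op a y0|).
  by rewrite (same_state_norm st) opprB addrA subrK.
apply: le_lt_trans (ler_normB _ _) _; rewrite (splitr e); apply: ltrD.
  exact: le_lt_trans (ler_dist_dist _ _) xa.
exact: le_lt_trans (ler_dist_dist _ _) ya.
Qed.

Lemma orbit_graph_linear (pi rho : representation O) (x0 : pi) (y0 : rho) (c : R[i]) x x' y y' :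
  orbit_graph x0 y0 x y -> orbit_graph x0 y0 x' y' ->
  orbit_graph x0 y0 (c *: x + x') (c *: y + y').
Proof.
move=> xy xy' e e0.
have e20 : 0 < e / 2 by rewrite divr_gt0.
have c0 : 0 < `|c| + 1 by rewrite ltr_wpDl.
have [a [xa ya]] := xy _ (divr_gt0 e20 c0).
have [b [xb yb]] := xy' _ e20.
have est (H : hilbertType R) (u u' w w' : H) : `|u - w| < e / 2 / (`|c| + 1) ->
    `|u' - w'| < e / 2 -> `|c *: u + u' - (c *: w + w')| < e.
  move=> uw uw'; rewrite opprD addrACA -scalerBr (splitr e).
  apply: le_lt_trans (ler_normD _ _) (ler_ltD _ uw').
  rewrite normrZ; move: uw; rewrite ltr_pdivlMr// => /ltW; apply: le_trans.
  by rewrite mulrC ler_wpM2l// lerDl.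
by exists (c *: a + b); rewrite !repD !repZ; split; apply: est.
Qed.

Lemma orbit_graph_op (pi rho : representation O) (x0 : pi) (y0 : rho) b x y :
  orbit_graph x0 y0 x y -> orbit_graph x0 y0 (rep_op b x) (rep_op b y).
Proof.
move=> xy e e0.
have M1 : 0 < (cnorm b + 1)%:C%C :> R[i] by rewrite ltcR ltr_wpDl ?cnorm_ge0.
have [a [xa ya]] := xy _ (divr_gt0 e0 M1).
have est (pi' : representation O) (u w : pi') : `|u - w| < e / (cnorm b + 1)%:C%C ->
    `|rep_op b u - rep_op b w| < e.
  rewrite ltr_pdivlMr// -op_B; apply: le_lt_trans.
  rewrite !rnormE -rmorphM lecR; apply: le_trans (rep_contractive _ _) _.
  by rewrite mulrC ler_wpM2l ?rnorm_ge0// lerDl.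
by exists (b * a); rewrite !repM; split; apply: est.
Qed.

Lemma orbit_graph_fun (pi rho : representation O) (x0 : pi) (y0 : rho) x y y' :
  same_state x0 y0 ->
  orbit_graph x0 y0 x y -> orbit_graph x0 y0 x y' -> y = y'.
Proof.
move=> st xy xy'; have := orbit_graph_norm st (orbit_graph_linear (-1) xy xy').
rewrite !scaleN1r addNr normr0 => /esym/eqP.
by rewrite normr_eq0 addrC subr_eq0 => /eqP.
Qed.

(** The closed relation [orbit_graph] is linear, isometric and total in both
    directions, hence the graph of a unitary operator. *)
Lemma gns_unique (pi rho : representation O) (x0 : pi) (y0 : rho) :
  cyclic_vector x0 -> cyclic_vector y0 -> same_state x0 y0 ->
  exists U : {linear pi -> rho},
    [/\ forall x y, inner (U x) (U y) = inner x y,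
        forall y, exists x, U x = y,
        forall a x, U (rep_op a x) = rep_op a (U x)
      & U x0 = y0].
Proof.
move=> cx cy st.
have [u uP] := choice (orbit_graph_total cx st).
have ulin : linear u.
  move=> c x y; apply: (orbit_graph_fun st (uP _)).
  exact: orbit_graph_linear.
pose Um := GRing.isLinear.Build R[i] pi rho *:%R u ulin.
pose U : {linear pi -> rho} := HB.pack u Um.
have st' : same_state y0 x0 by move=> a; rewrite st.
exists U; split.
- by apply: isometry_inner => x; rewrite -(orbit_graph_norm st (uP x)).
- move=> y; have [x xy] := orbit_graph_total cy st' y.
  by exists x; apply: (orbit_graph_fun st (uP x)); exact: orbit_graph_sym.
- by move=> a x; apply: (orbit_graph_fun st (uP _)); apply: orbit_graph_op.
- apply: (orbit_graph_fun st (uP _)) => e e0; exists 1.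
  by rewrite !rep1 !subrr !normr0.
Qed.

End GNS.

(** * A representation is determined by a cyclic chain *)

Section ChainUniqueness.
Context (R : realType) (N : nat) (A : 'M[bool]_N) (O : cstarAlgType R).
Context (s : 'I_N -> O) (ck : ck_family A s).
Context (gen : forall S : set O, cstar_subalgebra S -> (forall i, S (s i)) -> S = setT).
Context (h : nat -> 'I_N) (hA : forall n, A (h n) (h n.+1)).

(** The adjoint generators permute, up to a scalar, the vectors obtained from a
    chain, and how they do so depends on the chain only through [h]. *)
Lemma chain_adj_word i W n : exists (c : R[i]) W' n',
  forall (pi : representation O) (f : nat -> pi), chain s h f ->
  rep_op (star (s i)) (word_op s W (f n)) = c *: word_op s W' (f n').
Proof.
case: W => [|i' W].
  exists (i == h n)%:R, [::], n.+1 => pi f hf.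
  by rewrite !word_op_nil (chain_adj ck hA hf).
exists ((i == i')%:R * (A i (head (h n) W))%:R), W, n => pi f hf.
rewrite word_op_cons (ck_adj_op ck) -scalerA; congr (_ *: _).
case: W => [|j W]; last by rewrite word_op_cons (ck_initial ck).
by rewrite word_op_nil -(hf n) (ck_initial ck).
Qed.

Section TwoChains.
Context (pi pi' : representation O) (f : nat -> pi) (f' : nat -> pi').
Context (hf : chain s h f) (hf' : chain s h f').
Context (gram : forall m n, inner (f m) (f n) = inner (f' m) (f' n)).

Let rho (b : bool) := if b then pi else pi'.
Let sigma := direct_sum rho.
Let F : sigma := fun b => if b return rho b then f 0 else f' 0.
Let B (x : sigma) W n := inner (x true : pi) (word_op s W (f n)) -
                         inner (x false : pi') (word_op s W (f' n)).

(** The vectors of the direct sum on which the form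
    <x1, y1> - <x2, y2> vanishes against every (S_W f_n, S_W f'_n) form an
    invariant subspace containing (f_0, f'_0). *)
Let K := [set x : sigma | forall W n, B x W n = 0].

Let BD x y W n : B (x + y) W n = B x W n + B y W n.
Proof. by rewrite /B !innerDl opprD addrACA. Qed.

Let BZ (c : R[i]) x W n : B (c *: x) W n = c * B x W n.
Proof. by rewrite /B !innerZl mulrBr. Qed.

Let K_sub : subspace K.
Proof.
split=> [W n|c x y Kx Ky W n]; first by rewrite /B !inner0l subrr.
by rewrite BD BZ Kx Ky mulr0 addr0.
Qed.

Let K_closed : closed K.
Proof.
apply: closed_approx => x Kx W n; apply: real_eq0_approx => e e0.
set M := `|word_op s W (f n)| + `|word_op s W (f' n)| + 1.
have M0 : 0 < M by rewrite ltr_wpDl// addr_ge0.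
have [y Ky] := Kx _ (divr_gt0 e0 M0); rewrite ltr_pdivlMr// => xy.
have -> : B x W n = B (x - y) W n by rewrite -scaleN1r BD BZ Ky mulr0 addr0.
apply: le_lt_trans (ler_normB _ _) _; apply: le_lt_trans xy.
apply: le_trans (lerD (normr_inner_le _ _) (normr_inner_le _ _)) _.
apply: (@le_trans _ _ (`|x - y| * `|word_op s W (f n)| +
                       `|x - y| * `|word_op s W (f' n)|)).
  apply: lerD; rewrite ler_wpM2r//.
    exact: (hsum_proj_le true (x - y)).
  exact: (hsum_proj_le false (x - y)).
by rewrite -mulrDr ler_wpM2l// lerDl.
Qed.

Let K_invariant : invariant_subspace K.
Proof.
apply: (invariant_subspace_gen gen K_sub K_closed) => i x Kx W n.
  have [c [W' [n' cE]]] := chain_adj_word i W n.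
  transitivity (c^* * B x W' n'); last by rewrite Kx mulr0.
  rewrite /B !(op_star_r (s i)) (cE _ _ hf) (cE _ _ hf') !innerZr.
  by rewrite mulrBr.
transitivity (B x (i :: W) n); last exact: Kx.
by rewrite /B !word_op_cons -!(rep_star (s i)).
Qed.

Let KF : K F.
Proof.
move=> W n; rewrite /B -!word_adjP !(chain_word_adj ck hA) // !innerZl.
by rewrite gram subrr.
Qed.

Lemma chain_same_state : same_state (f 0) (f' 0).
Proof.
move=> a; have [_ _ _ Ki] := K_invariant.
have := Ki a F KF [::] 0%N; rewrite /B !word_op_nil => /eqP.
by rewrite subr_eq0 => /eqP.
Qed.

(** The unitary respects the whole chains because [f n] is an adjoint word
    applied to [f 0]. *)
Lemma chain_unitary : cyclic_vector (f 0) -> cyclic_vector (f' 0) ->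
  exists U : {linear pi -> pi'},
    [/\ forall x y, inner (U x) (U y) = inner x y,
        forall y, exists x, U x = y,
        forall a x, U (rep_op a x) = rep_op a (U x)
      & forall n, U (f n) = f' n].
Proof.
move=> cf cf'.
have [U [Ui Us Ua U0]] := gns_unique cf cf' chain_same_state.
exists U; split=> // n.
have E (tau : representation O) (g : nat -> tau) : chain s h g ->
    g n = word_adj s (segment h 0 n) (g 0).
  move=> hg; rewrite (chain_word_adj ck hA hg) size_map size_iota eqxx.
  by rewrite scale1r.
by rewrite (E _ _ hf) (E _ _ hf') /word_adj Ua U0.
Qed.

End TwoChains.
End ChainUniqueness.

(** * The chain of a representation P(J; z) *)

Section PeriodicChains.
Context (R : realType) (N : nat) (O : cstarAlgType R) (s : 'I_N -> O).

(** The defining property of P(J; z) unrolled along the powers of the word: the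
    phase [z] appears only in the comparison of [f n] with [f (n + k)], and
    shifting [n] corresponds to rotating the word. *)
Definition periodic_chain (pi : representation O) (h : nat -> 'I_N) k (z : R[i]) (f : nat -> pi) :=
  [/\ chain s h f,
      forall n, f n = z *: f (n + k)%N,
      forall l m : 'I_k, inner (f l) (f m) = (l == m)%:R
    & cyclic_vector (f 0)].

Definition periodize (i0 : 'I_N) (J : seq 'I_N) n := nth i0 J (n %% size J).

(** The quotient n %/ size J counts the turns already made around the word, each
    of which contributes a factor z^-1. *)
Lemma is_P_periodic_chain (pi : representation O) i0 J (z : R[i]) :
  J != [::] -> z != 0 -> is_P s J z pi ->
  exists f : nat -> pi, periodic_chain (periodize i0 J) (size J) z f.
Proof.
move=> J0 z0 [W [W1 cyc zW orth]].
have k0 : (0 < size J)%N by rewrite lt0n size_eq0.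
pose g l := word_op s (drop l J) W.
have g0 : g 0 = z *: W by rewrite /g drop0.
have gk : g (size J) = W by rewrite /g drop_size word_op_nil.
have gS l : (l < size J)%N -> rep_op (s (nth i0 J l)) (g l.+1) = g l.
  by move=> lk; rewrite /g (drop_nth i0 lk) word_op_cons.
exists (fun n => z ^- (n %/ size J) *: g (n %% size J)%N); split.
- move=> n; rewrite /periodize op_Z.
  have nk : (n %% size J < size J)%N by rewrite ltn_pmod.
  have nE : n.+1 = (n %/ size J * size J + (n %% size J).+1)%N.
    by rewrite addnS -divn_eq.
  (* The step from n to n + 1 stays inside the word or closes a turn. *)
  have [lt|] := ltnP (n %% size J).+1 (size J).
    rewrite {1 2}nE divnMDl// modnMDl (divn_small lt) (modn_small lt) addn0.
    by rewrite -(gS _ nk).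
  move=> le; have kE : (n %% size J).+1 = size J by apply/eqP; rewrite eqn_leq nk le.
  have nE' : n.+1 = ((n %/ size J).+1 * size J)%N by rewrite nE kE mulSn addnC.
  rewrite {1 2}nE' mulnK// modnMl g0 op_Z scalerA exprS invfM mulrAC mulVf// mul1r.
  by rewrite -gk -{3}kE gS.
- move=> n; rewrite divnDr ?dvdnn// divnn k0 addn1 modnDr scalerA exprS invfM.
  by rewrite mulrA mulfV// mul1r.
- move=> l m; rewrite !divn_small// !modn_small// expr0 invr1 !scale1r.
  exact: orth.
- apply: full_cyclic_vector => K Ki K0; apply: (cyclic_vector_full cyc Ki).
  have [_ Kl _ _] := Ki; have [K00 _ _ _] := Ki.
  have : K (z^-1 *: (z ^- (0 %/ size J) *: g (0 %% size J)%N)).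
    by rewrite -[_ *: _]addr0; exact: Kl.
  by rewrite div0n mod0n expr0 invr1 scale1r g0 scalerA mulVf// scale1r.
Qed.

Section PeriodicChainTheory.
Context (pi : representation O) (h : nat -> 'I_N) (k : nat) (z : R[i]) (f : nat -> pi).
Context (k0 : (0 < k)%N) (z1 : `|z| = 1) (hf : periodic_chain h k z f).

Let z0 : z != 0.
Proof. by rewrite -normr_eq0 z1 oner_eq0. Qed.

Lemma pchain_period q n : f (n + q * k)%N = z ^- q *: f n.
Proof.
case: hf => _ per _ _; elim: q => [|q IH].
  by rewrite mul0n addn0 expr0 invr1 scale1r.
rewrite (_ : (n + q.+1 * k = n + q * k + k)%N); last by rewrite mulSn; lia.
apply: (scalerI z0); rewrite -per IH scalerA exprS invfM mulrA mulfV//.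
by rewrite mul1r.
Qed.

Lemma pchain_modn n : f n = z ^- (n %/ k) *: f (n %% k)%N.
Proof. by rewrite -pchain_period addnC -divn_eq. Qed.

Lemma pchain_inner m n : inner (f m) (f n) =
  (m %% k == n %% k)%N%:R * (z ^- (m %/ k) * (z ^- (n %/ k))^*).
Proof.
case: hf => _ _ orth _; rewrite (pchain_modn m) (pchain_modn n) innerZl innerZr.
have := orth (Ordinal (ltn_pmod m k0)) (Ordinal (ltn_pmod n k0)) => /= ->.
by rewrite [RHS]mulrC mulrA.
Qed.

Lemma pchain_norm n : inner (f n) (f n) = 1.
Proof. by rewrite pchain_inner eqxx mul1r -normCK normfV normrX z1 expr1n invr1 expr1n. Qed.

Lemma pchain_cyclic n : cyclic_vector (f n).
Proof.
case: hf => ch _ _ cyc; apply: full_cyclic_vector => K Ki Kn.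
apply: (cyclic_vector_full cyc Ki); rewrite -(chain_op ch 0 n).
by case: Ki => _ _ _; apply.
Qed.

Lemma pchain_shift d : periodic_chain (fun n => h (n + d)%N) k z (fun n => f (n + d)%N).
Proof.
case: (hf) => ch per _ _; split.
- by move=> n; rewrite -(ch (n + d)%N).
- by move=> n; rewrite per addnAC.
- move=> l m; have lmE : ((l + d) %% k == (m + d) %% k)%N = (l == m).
    by rewrite eqn_modDr !modn_small.
  rewrite pchain_inner lmE; case: eqVneq => [->|_]; last by rewrite mul0r.
  transitivity (inner (f (m + d)%N) (f (m + d)%N)); last exact: pchain_norm.
  by rewrite pchain_inner eqxx.
- exact: (pchain_cyclic (0 + d)).
Qed.

End PeriodicChainTheory.
End PeriodicChains.

(** * Long adjoint words and irreducibility *)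

Section ChainProjection.
Context (R : realType) (N : nat) (A : 'M[bool]_N) (O : cstarAlgType R).
Context (s : 'I_N -> O) (ck : ck_family A s).
Context (gen : forall S : set O, cstar_subalgebra S -> (forall i, S (s i)) -> S = setT).
Context (pi : representation O) (h : nat -> 'I_N) (hA : forall n, A (h n) (h n.+1)).
Context (k : nat) (z : R[i]) (f : nat -> pi).
Context (k0 : (0 < k)%N) (z1 : `|z| = 1) (hf : periodic_chain s h k z f).

Let z0 : z != 0.
Proof. by rewrite -normr_eq0 z1 oner_eq0. Qed.

(** The orthogonal projection onto the span of the chain. *)
Definition pchain_proj (x : pi) : pi := \sum_(l < k) inner x (f l) *: f l.

Let res x := x - pchain_proj x.

Let res_lin (c : R[i]) x y : res (c *: x + y) = c *: res x + res y.
Proof.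
rewrite /res scalerBr addrACA; congr (_ + _); rewrite -opprD; congr (- _).
rewrite /pchain_proj scaler_sumr -big_split; apply: eq_bigr => l _ /=.
by rewrite innerDl innerZl scalerDl scalerA.
Qed.

Let res_0 : res 0 = 0.
Proof.
rewrite /res /pchain_proj big1 ?subrr// => l _.
by rewrite inner0l scale0r.
Qed.

Let res_bound x : `|res x| <= (k%:R + 1) * `|x|.
Proof.
apply: le_trans (ler_normB _ _) _; rewrite mulrDl mul1r addrC lerD2r.
apply: le_trans (ler_norm_sum _ _ _) _.
rewrite mulr_natl -[X in _ <= _ *+ X]card_ord -sumr_const; apply: ler_sum => l _.
have f1 : `|f l| = 1.
  apply/eqP; rewrite -(@eqrXn2 _ 2)// expr1n normr_inner.
  by rewrite (pchain_norm k0 z1 hf).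
by rewrite normrZ f1 mulr1 -[leRHS]mulr1 -f1 normr_inner_le.
Qed.

Let res_f n : res (f n) = 0.
Proof.
apply/eqP; rewrite subr_eq0; apply/eqP; rewrite /pchain_proj.
case: (hf) => _ _ orth _; pose r := Ordinal (ltn_pmod n k0).
rewrite (pchain_modn k0 z1 hf n) (bigD1 r)//= big1 ?addr0 => [|l lr].
  by rewrite innerZl (orth r r) eqxx mulr1.
by rewrite innerZl (orth r l) eq_sym (negPf lr) mulr0 scale0r.
Qed.

(** The adjoint of a letter kills S_i x or removes its first letter, so that the
    property is inherited by the subspaces invariant under the generators and
    their adjoints; it is closed because adjoint words are contractions; and it
    holds for [f 0], whose images under adjoint words stay on the chain. *)
Lemma word_adj_asymptotic (x : pi) (e : R[i]) : 0 < e ->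
  exists n0, forall W, (n0 <= size W)%N ->
    `|word_adj s W x - pchain_proj (word_adj s W x)| < e.
Proof.
pose K := [set x : pi | forall e : R[i], 0 < e ->
  exists n0, forall W, (n0 <= size W)%N -> `|res (word_adj s W x)| < e].
have Ksub : subspace K.
  split=> [e' e0|c u v Ku Kv e' e0].
    by exists 0%N => W _; rewrite /word_adj op_0 res_0 normr0.
  have e20 : 0 < e' / 2 by rewrite divr_gt0.
  have c0 : 0 < `|c| + 1 by rewrite ltr_wpDl.
  have [n0 h0] := Ku _ (divr_gt0 e20 c0).
  have [n1 h1] := Kv _ e20.
  exists (maxn n0 n1) => W; rewrite geq_max => /andP[W0 W1].
  rewrite /word_adj op_lin res_lin (splitr e').
  apply: le_lt_trans (ler_normD _ _) (ler_ltD _ (h1 W W1)).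
  rewrite normrZ; move: (h0 W W0); rewrite ltr_pdivlMr// => /ltW; apply: le_trans.
  by rewrite mulrC ler_wpM2l// lerDl.
have Kcl : closed K.
  apply: closed_approx => u Ku e' e0.
  have e20 : 0 < e' / 2 by rewrite divr_gt0.
  have k1 : 0 < k%:R + 1 :> R[i] by rewrite ltr_wpDl.
  have [v Kv uv] := Ku _ (divr_gt0 e20 k1).
  have [n0 h0] := Kv _ e20; exists n0 => W /h0 hW.
  have -> : word_adj s W u = 1 *: word_adj s W (u - v) + word_adj s W v.
    by rewrite scale1r /word_adj op_B subrK.
  rewrite res_lin scale1r (splitr e').
  apply: le_lt_trans (ler_normD _ _) (ler_ltD _ hW).
  apply: le_trans (res_bound _) _; move: uv; rewrite ltr_pdivlMr// => /ltW.
  apply: le_trans; rewrite mulrC; apply: ler_wpM2r; first exact: ltW.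
  exact: (word_adj_contract ck).
have Kinv : invariant_subspace K.
  apply: (invariant_subspace_gen gen Ksub Kcl) => i u Ku e' e0.
    have [n0 h0] := Ku _ e0; exists n0.+2 => -[//|i' [//|j W]] /= sW.
    rewrite word_adj_cons (ck_adj_op ck) /word_adj op_Z -/(word_adj s _ _).
    rewrite word_adj_cons (ck_adj_initial ck) /word_adj op_Z -/(word_adj s _ _).
    rewrite -word_adj_cons scalerA -natrM mulnb.
    case: (_ && _); last by rewrite scale0r res_0 normr0.
    by rewrite scale1r; apply: h0; exact: ltnW.
  have [n0 h0] := Ku _ e0; exists n0 => W sW.
  by rewrite -word_adj_cons h0// leqW.
move=> e0; suff : K x by move=> /(_ e e0).
rewrite (cyclic_vector_full _ Kinv (x0 := f 0))//; first by case: hf.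
move=> e' e'0; exists 0%N => W _; rewrite (chain_word_adj ck hA); last by case: hf.
by rewrite -[_ *: _]addr0 res_lin res_f res_0 scaler0 addr0 normr0.
Qed.

(** The vectors of any second chain with a period reproduce themselves, up to
    phases, under arbitrarily long adjoint words. *)
Lemma pchain_proj_absorb (h' : nat -> 'I_N) k' (z' : R[i]) (y : nat -> pi) :
  (forall n, A (h' n) (h' n.+1)) -> chain s h' y -> (0 < k')%N -> `|z'| = 1 ->
  (forall n, y n = z' *: y (n + k')%N) ->
  forall n, y n = pchain_proj (y n).
Proof.
move=> hA' ch k'0 z'1 per n.
apply/eqP; rewrite -subr_eq0 -normr_eq0; apply/eqP/real_eq0_approx => e e0.
rewrite normr_id -/(res _).
have [n0 h0] := word_adj_asymptotic (y n) e0.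
have iter q : y n = z' ^+ q *: y (n + q * k')%N.
  elim: q => [|q IH]; first by rewrite mul0n addn0 scale1r.
  by rewrite IH per scalerA -exprSr -addnA mulSn (addnC k').
pose W := segment h' n (n0 * k').
have sW : size W = (n0 * k')%N by rewrite size_map size_iota.
have := h0 W; rewrite sW leq_pmulr// => /(_ isT).
rewrite (chain_word_adj ck hA' ch) sW eqxx scale1r.
rewrite (iter n0) -[_ *: _]addr0 res_lin res_0 addr0 normrZ.
by rewrite normrX z'1 expr1n mul1r.
Qed.

Lemma inner_cyclic_eq0 (x : pi) : (forall a, inner x (rep_op a (f 0)) = 0) -> x = 0.
Proof.
move=> x0; apply/eqP; rewrite -(dnorm_eq0 (@inner R pi)); apply/eqP/real_eq0_approx => e e0.
have x1 : 0 < `|x| + 1 by rewrite ltr_wpDl.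
have : closure (range (fun a : O => rep_op a (f 0))) x by case: hf => _ _ _ ->.
move=> /closure_approx /(_ _ (divr_gt0 e0 x1))[_ [a _ <-]].
rewrite ltr_pdivlMr// => xa.
rewrite -[inner x x]subr0 -(x0 a) -innerBr; apply: le_lt_trans (normr_inner_le _ _) _.
by apply: le_lt_trans xa; rewrite mulrC ler_wpM2l// lerDl.
Qed.

(** Let J be the word of the first [k] letters.  Since J differs from its other
    rotations, S_J^* kills all the vectors of one turn except [f 0], so S_W^* x
    with W = J^(q+1) approaches the line of [f k], with a coefficient of modulus
    |<x, f_0>|.  If this is nonzero for some [x] in an invariant subspace, the
    subspace contains a cyclic vector; otherwise it is orthogonal to one. *)
Lemma aperiodic_irreducible :
  (forall l : 'I_k, segment h 0 k = segment h l k -> l = 0%N :> nat) ->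
  irreducible_rep pi.
Proof.
move=> aper; have [ch per orth cyc] := hf; split.
  exists (f 0); rewrite -(dnorm_eq0 (@inner R pi)) (pchain_norm k0 z1 hf).
  exact: oner_neq0.
move=> K Kinv; have [[x Kx x0]|nx] := pselect (exists2 x, K x & inner x (f 0) != 0).
  right; apply: (cyclic_vector_full (pchain_cyclic hf k) Kinv).
  have [K0 Kl Kc Ki] := Kinv; apply: closed_mem => // e e0.
  have c0 : 0 < `|inner x (f 0)| by rewrite normr_gt0.
  have [q0 h0] := word_adj_asymptotic x (mulr_gt0 e0 c0).
  pose W := segment h 0 (q0 * k); pose J := segment h 0 k.
  (* S_W maps f 0 = z^q0 f (q0 k) to z^q0 f 0. *)
  pose c := inner x (z ^+ q0 *: f 0).
  have cn : `|c| = `|inner x (f 0)|.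
    by rewrite /c innerZr normrM norm_conjC normrX z1 expr1n mul1r.
  have c1 : c != 0 by rewrite -normr_eq0 cn normr_eq0.
  have WE : word_op s W (f 0) = z ^+ q0 *: f 0.
    rewrite -{2}(chain_op ch 0 (q0 * k)) (pchain_period k0 z1 hf) /word_op op_Z scalerA.
    by rewrite mulfV ?scale1r// expf_neq0.
  pose y := word_adj s W x.
  have Py : word_adj s J (pchain_proj y) = c *: f k.
    have term l : word_adj s J (inner y (f l) *: f l) =
        (J == segment h l k)%:R *: (inner y (f l) *: f (l + k)%N).
      rewrite /word_adj op_Z -/(word_adj s J _) (chain_word_adj ck hA ch).
      by rewrite size_map size_iota scalerA mulrC -scalerA.
    rewrite /pchain_proj {1}/word_adj op_sum (bigD1 (Ordinal k0))//=.
    rewrite -/(word_adj s J _) term eqxx scale1r word_adjP WE big1 ?addr0// => l l0.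
    rewrite -/(word_adj s J _) term; case: eqP => [/aper lE|_]; last by rewrite scale0r.
    by case/eqP: l0; apply: val_inj.
  exists (c^-1 *: word_adj s J y).
    by rewrite -[_ *: _]addr0; apply: Kl => //; do 2 apply: (Ki).
  have -> : f k = c^-1 *: word_adj s J (pchain_proj y) by rewrite Py scalerA mulVf// scale1r.
  rewrite -scalerBr normrZ normfV cn ltr_pdivrMl// mulrC.
  have -> : word_adj s J (pchain_proj y) - word_adj s J y = word_adj s J (pchain_proj y - y).
    by rewrite /word_adj op_B.
  apply: le_lt_trans (word_adj_contract ck _ _) _; rewrite distrC.
  by apply: h0; rewrite size_map size_iota leq_pmulr.
left; apply/seteqP; split=> x; last by move=> ->; case: Kinv.
move=> Kx; apply: inner_cyclic_eq0 => a; rewrite -rep_star.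
apply: contrapT => /eqP n0; apply: nx; exists (rep_op (star a) x) => //.
by case: Kinv => _ _ _; apply.
Qed.

(** A nonzero coefficient between two chains forces their letters to agree
    forever, and it is then constant along the chains. *)
Lemma chain_overlap (h' : nat -> 'I_N) (y : nat -> pi) : chain s h' y ->
  forall m r, inner (y m) (f r) != 0 ->
  forall n, h' (m + n)%N = h (r + n)%N /\ inner (y (m + n)%N) (f (r + n)%N) = inner (y m) (f r).
Proof.
move=> ch m r yf.
have st i j : inner (y i) (f j) = (h' i == h j)%:R * inner (y i.+1) (f j.+1).
  case: hf => chf _ _ _; rewrite -{1}(ch i) op_star_r (chain_adj ck hA chf) innerZr.
  by rewrite conjC_nat.
have nz n : inner (y (m + n)%N) (f (r + n)%N) = inner (y m) (f r).
  elim: n => [|n IH]; first by rewrite !addn0.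
  rewrite !addnS -IH [RHS]st; case: eqP => [_|hn]; first by rewrite mul1r.
  by case/eqP: yf; rewrite -IH st; case: eqP hn => // _ _; rewrite mul0r.
move=> n; split=> //; have := nz n; rewrite st; case: eqP => // _.
by rewrite mul0r => e; case/eqP: yf.
Qed.

(** A second chain with its own period lies in the span of the first one, which
    bounds the length of its period by the rank of the matrix of coefficients. *)
Lemma chain_comparison (h' : nat -> 'I_N) k' (z' : R[i]) (y : nat -> pi) :
  (forall n, A (h' n) (h' n.+1)) -> chain s h' y -> (0 < k')%N -> `|z'| = 1 ->
  (forall n, y n = z' *: y (n + k')%N) ->
  (forall l m : 'I_k', inner (y l) (y m) = (l == m)%:R) ->
  (k' <= k)%N /\ exists r, (r < k)%N /\ inner (y 0) (f r) != 0.
Proof.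
move=> hA' ch k'0 z'1 per orth.
have ab := pchain_proj_absorb hA' ch k'0 z'1 per.
split; last first.
  apply: contrapT => nr; have y0 : y 0 = 0.
    rewrite ab /pchain_proj big1// => l _.
    have [->|yl] := eqVneq (inner (y 0) (f l)) 0; first by rewrite scale0r.
    by case: nr; exists l.
  have := orth (Ordinal k'0) (Ordinal k'0); rewrite /= y0 inner0l ?eqxx => /esym/eqP.
  by rewrite oner_eq0.
pose C : 'M[R[i]]_(k', k) := \matrix_(i, j) inner (y i) (f j).
pose D : 'M[R[i]]_(k, k') := \matrix_(i, j) inner (f i) (y j).
have CD : C *m D = 1%:M.
  apply/matrixP => i j; rewrite !mxE -orth (ab i) /pchain_proj inner_suml.
  by apply: eq_bigr => l _; rewrite !mxE innerZl.
have := mxrankM_maxl C D; rewrite CD mxrank1 => /leq_trans; apply.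
exact: rank_leq_col.
Qed.

End ChainProjection.

(** * Periodic extensions of finite words *)

Section Words.
Context (N : nat) (i0 : 'I_N).
Implicit Types J : seq 'I_N.

Lemma periodizeD J n : periodize i0 J (n + size J) = periodize i0 J n.
Proof. by rewrite /periodize modnDr. Qed.

Lemma periodizeMD J n q : periodize i0 J (n + q * size J) = periodize i0 J n.
Proof. by rewrite /periodize addnC modnMDl. Qed.

Lemma size_word_pow J p : size (word_pow J p) = (p * size J)%N.
Proof. by rewrite /word_pow size_flatten /shape map_nseq sumn_nseq mulnC. Qed.

Lemma nth_word_pow J p l : (l < p * size J)%N ->
  nth i0 (word_pow J p) l = periodize i0 J l.
Proof.
elim: p l => [//|p IH] l; rewrite mulSn => lp.
rewrite /word_pow /= -/(word_pow J p) nth_cat; case: ltnP => lJ.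
  by rewrite /periodize modn_small.
by rewrite IH; [rewrite -{2}(subnK lJ) periodizeD|rewrite ltn_subLR].
Qed.

Lemma periodize_word_pow J p n : (0 < size J)%N -> (0 < p)%N ->
  periodize i0 (word_pow J p) n = periodize i0 J n.
Proof.
move=> J0 p0; rewrite {1}/periodize nth_word_pow size_word_pow.
  by rewrite /periodize modn_dvdm// dvdn_mull.
by rewrite ltn_pmod// muln_gt0 p0.
Qed.

Lemma periodize_rot J n m : (n <= size J)%N ->
  periodize i0 (rot n J) m = periodize i0 J (m + n).
Proof.
move=> nJ; have [J0|J0] := posnP (size J).
  by rewrite (size0nil J0) /periodize !nth_nil.
rewrite /periodize size_rot /rot nth_cat size_drop nth_drop.
have mJ : (m %% size J < size J)%N by rewrite ltn_pmod.
rewrite -(modnDml m n); case: ltnP => h.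
  have lt : (m %% size J + n < size J)%N by lia.
  by rewrite (modn_small lt) addnC.
rewrite nth_take; last by lia.
have le : (size J <= m %% size J + n)%N by lia.
have lt : (m %% size J + n - size J < size J)%N by lia.
rewrite -(subnK le) modnDr (modn_small lt).
by congr nth; lia.
Qed.

Lemma segment_periodize J : segment (periodize i0 J) 0 (size J) = J.
Proof.
apply: (@eq_from_nth _ i0); first by rewrite size_map size_iota.
move=> i; rewrite size_map size_iota => iJ.
by rewrite (nth_map 0%N) ?size_iota// nth_iota// /periodize modn_small.
Qed.

Lemma eq_periodize J J' : size J = size J' ->
  (forall n, periodize i0 J n = periodize i0 J' n) -> J = J'.
Proof.
move=> sJ JJ'; rewrite -(segment_periodize J) -(segment_periodize J') sJ.
exact: eq_map.
Qed.

Lemma cyclic_word_periodize (A : 'M[bool]_N) J : cyclic_word A J ->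
  forall n, A (periodize i0 J n) (periodize i0 J n.+1).
Proof.
case: J => [[]//|x J] [_ /= /(pathP i0) hp] n; rewrite size_rcons in hp.
have := hp (n %% (size J).+1)%N; rewrite ltn_pmod// => /(_ isT).
rewrite /periodize /= -rcons_cons nth_rcons /= ltn_pmod//.
congr (is_true (A _ _)).
rewrite nth_rcons -(addn1 n) -modnDml addn1.
have : (n %% (size J).+1 < (size J).+1)%N by rewrite ltn_pmod.
rewrite ltnS leq_eqVlt => /orP[/eqP ->|lt].
  by rewrite ltnn eqxx modnn.
by rewrite lt (@modn_small (n %% (size J).+1).+1).
Qed.

(** A word fixed by a rotation of length [l] is, by Bezout, fixed by a rotation
    of length gcd(l, size J), hence a power of its prefix of that length. *)
Lemma aperiodic_segment J (l : 'I_(size J)) : ~ periodic_word J ->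
  segment (periodize i0 J) 0 (size J) = segment (periodize i0 J) l (size J) ->
  l = 0%N :> nat.
Proof.
set h := periodize i0 J => aper seg.
have [//|l0] := posnP l; case: aper.
have J0 : (0 < size J)%N by apply: leq_ltn_trans (ltn_ord l).
have hl n : h (n + l)%N = h n.
  have small i : (i < size J)%N -> h (i + l)%N = h i.
    move=> iJ; have := congr1 (fun s => nth i0 s i) seg.
    by rewrite !(nth_map 0%N) ?size_iota// !nth_iota// add0n (addnC l).
  rewrite {1}(divn_eq n (size J)) addnC addnA addnC addnC -/h.
  rewrite (_ : (l + n %/ size J * size J + n %% size J =
     n %% size J + l + n %/ size J * size J)%N); last by lia.
  by rewrite /h periodizeMD -/h small ?ltn_pmod// /h /periodize modn_mod.
have hlM q n : h (n + q * l)%N = h n.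
  by elim: q => [|q IH]; rewrite ?mul0n ?addn0// mulSn (addnC l) addnA hl.
pose g := gcdn (size J) l.
have g0 : (0 < g)%N by rewrite gcdn_gt0 J0.
have hg n : h (n + g)%N = h n.
  have [a _ /dvdnP[q qE]] := Bezoutl l J0.
  by rewrite -(hlM a) -addnA qE /h periodizeMD.
have gJ : (g %| size J)%N by exact: dvdn_gcdl.
have gl : (g <= l)%N by rewrite dvdn_leq// dvdn_gcdr.
have gltJ : (g < size J)%N by apply: leq_ltn_trans gl _.
have sg : size (take g J) = g by rewrite size_take gltJ.
exists (take g J), (size J %/ g)%N; split; first by rewrite sg.
  by rewrite leq_divRL// mul2n -addnn; case/dvdnP: gJ gltJ => q ->; case: q => [|[|q]]; lia.
have gdiv : (size J %/ g * g)%N = size J by rewrite divnK.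
apply: (@eq_from_nth _ i0); first by rewrite size_word_pow sg gdiv.
move=> i iJ; rewrite nth_word_pow ?sg ?gdiv// /periodize sg nth_take ?ltn_pmod//.
have hgM q n : h (n + q * g)%N = h n.
  by elim: q => [|q IH]; rewrite ?mul0n ?addn0// mulSn (addnC g) addnA hg.
have := hgM (i %/ g)%N (i %% g)%N; rewrite addnC -divn_eq /h /periodize.
by rewrite (modn_small iJ) (modn_small (leq_ltn_trans (leq_mod i g) iJ)).
Qed.

Lemma word_rotationP J J' : word_rotation J J' <->
  size J = size J' /\ exists2 r, (r <= size J)%N &
    forall n, periodize i0 J' n = periodize i0 J (n + r).
Proof.
split=> [[n ->]|[sJ [r rJ hr]]].
  have [nJ|/ltnW nJ] := leqP n (size J).
    rewrite size_rot; split=> //; exists n => // m; exact: periodize_rot.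
  by rewrite rot_oversize//; split=> //; exists 0%N => // m; rewrite addn0.
exists r; apply: eq_periodize; first by rewrite size_rot.
by move=> n; rewrite hr periodize_rot.
Qed.

End Words.

(** * Reducibility for periodic words, and classification *)

Lemma unitary_equiv_sym (R : realType) (O : cstarAlgType R) (pi rho : representation O) :
  unitary_equiv pi rho -> unitary_equiv rho pi.
Proof.
move=> [U [Ui Us Ua]]; have [g gK] := choice Us.
have Uinj x y : U x = U y -> x = y.
  move=> xy; apply/eqP; rewrite -subr_eq0 -(dnorm_eq0 (@inner R pi)) -Ui.
  by rewrite linearB xy subrr inner0l.
have glin : linear g by move=> c x y; apply: Uinj; rewrite linearP !gK.
pose V : {linear rho -> pi} := HB.pack g (GRing.isLinear.Build R[i] rho pi *:%R g glin).
exists V; split=> [x y|y|a x]; first by rewrite -Ui !gK.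
  by exists (U y); apply: Uinj; rewrite gK.
by apply: Uinj; rewrite Ua !gK.
Qed.

Section Equivalence.
Context (R : realType) (N : nat) (A : 'M[bool]_N) (O : cstarAlgType R).
Context (s : 'I_N -> O) (ck : ck_family A s).
Context (gen : forall S : set O, cstar_subalgebra S -> (forall i, S (s i)) -> S = setT).

Lemma pchain_unitary (pi pi' : representation O) (h : nat -> 'I_N) k (z : R[i])
    (f : nat -> pi) (f' : nat -> pi') :
  (forall n, A (h n) (h n.+1)) -> (0 < k)%N -> `|z| = 1 ->
  periodic_chain s h k z f -> periodic_chain s h k z f' ->
  exists U : {linear pi -> pi'},
    [/\ forall x y, inner (U x) (U y) = inner x y,
        forall y, exists x, U x = y,
        forall a x, U (rep_op a x) = rep_op a (U x)
      & forall n, U (f n) = f' n].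
Proof.
move=> hA k0 z1 hf hf'; have [ch _ _ cyc] := hf; have [ch' _ _ cyc'] := hf'.
apply: (chain_unitary ck gen hA ch ch' _ cyc cyc') => m n.
by rewrite (pchain_inner k0 z1 hf) (pchain_inner k0 z1 hf').
Qed.

(** The shifted chain is a chain for the same data, so uniqueness yields a unitary
    [U] commuting with the representation and sending [f n] to [f (n + d)].  Its
    [m]-th power is a scalar without [U] being one, and an eigenspace of [U] is
    a proper invariant subspace. *)
Lemma periodic_reducible (pi : representation O) (h : nat -> 'I_N) d m (z : R[i])
    (f : nat -> pi) :
  (forall n, A (h n) (h n.+1)) -> (forall n, h (n + d)%N = h n) ->
  (0 < d)%N -> (1 < m)%N -> `|z| = 1 ->
  periodic_chain s h (m * d) z f -> ~ irreducible_rep pi.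
Proof.
move=> hA hd d0 m1 z1 hf [_ irr].
have k0 : (0 < m * d)%N by rewrite muln_gt0 d0 ltnW.
have hf' : periodic_chain s h (m * d) z (fun n => f (n + d)%N).
  by rewrite -(funext hd); exact: pchain_shift.
have [U [Ui _ Ua Uf]] := pchain_unitary hA k0 z1 hf hf'.
have z0 : z != 0 by rewrite -normr_eq0 z1 oner_eq0.
have m0 : (0 < m)%N by exact: ltnW.
pose v : R[i] := m.-root z^-1.
have vm : v ^+ m = z^-1 by rewrite rootCK.
have v0 : v != 0.
  apply/eqP => v0; move: vm; rewrite v0 expr0n gtn_eqF//= => /esym/eqP.
  by rewrite invr_eq0 (negPf z0).
have Un x : `|U x| = `|x|.
  by apply/eqP; rewrite -(@eqrXn2 _ 2)// !normr_inner Ui.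
pose K := [set x : pi | U x = v *: x].
have Kinv : invariant_subspace K.
  split.
  - by rewrite /K /= linear0 scaler0.
  - move=> c x y Kx Ky; rewrite /K /= linearP Kx Ky scalerDr !scalerA.
    by rewrite mulrC.
  - apply: closed_approx => x Kx; apply/eqP; rewrite -subr_eq0 -normr_eq0.
    apply/eqP/real_eq0_approx => e e0; rewrite normr_id.
    have v1 : 0 < `|v| + 1 by rewrite ltr_wpDl.
    have [y Ky] := Kx _ (divr_gt0 e0 v1); rewrite ltr_pdivlMr// => xy.
    have -> : U x - v *: x = U (x - y) - v *: (x - y).
      by rewrite linearB Ky scalerBr opprB addrA subrK.
    apply: le_lt_trans (ler_normB _ _) _; apply: le_lt_trans xy.
    by rewrite Un normrZ mulrDr mulr1 addrC mulrC.
  - by move=> a x Kx; rewrite /K /= Ua Kx op_Z.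
(* The Fourier sum over the orbit of f 0 under U is an eigenvector. *)
pose t r : pi := v ^- r *: f (r * d)%N.
have Ut r : U (t r) = v *: t r.+1.
  rewrite /t linearZ Uf scalerA exprS invfM mulrA mulfV// mul1r.
  by rewrite mulSn addnC.
have tm : t m = t 0.
  rewrite /t vm -[(m * d)%N]add0n -[(0 + _)%N]/(0 + m * d)%N expr0 invr1 invrK mul0n.
  by case: hf => _ -> _ _; rewrite add0n scale1r.
pose g := \sum_(r < m) t r.
have Kg : K g.
  rewrite /K /= linear_sum scaler_sumr.
  under eq_bigr => r _ do rewrite Ut.
  rewrite -!scaler_sumr; congr (_ *: _); apply: (addrI (t 0)).
  have := @big_ord_recl _ 0 +%R m (fun r : 'I_m.+1 => t r); rewrite big_ord_recr /= tm addrC.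
  by move=> ->.
have small r : (r < m)%N -> inner (f (r * d)%N) (f 0) = (r == 0)%N%:R.
  move=> rm; have rmd : (r * d < m * d)%N by rewrite ltn_pmul2r.
  have [_ _ orth _] := hf; have := orth (Ordinal rmd) (Ordinal k0) => /= ->.
  by rewrite -val_eqE /= muln_eq0 (gtn_eqF d0) orbF.
have gf : inner g (f 0) = 1.
  rewrite inner_suml (bigD1 (Ordinal m0))//= big1 ?addr0 => [|r r0].
    by rewrite innerZl small// expr0 invr1 mul1r.
  rewrite innerZl small//; case: eqP => [rE|_]; last by rewrite mulr0.
  by case/eqP: r0; apply: val_inj.
have [K0|KT] := irr K Kinv.
  have /= g0 : [set 0] g by rewrite -K0.
  by move: gf; rewrite g0 inner0l => /esym/eqP; rewrite oner_eq0.
have : K (f 0) by rewrite KT.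
rewrite /K /= Uf add0n => /(congr1 (fun x => inner x (f 0))).
rewrite innerZl (pchain_norm k0 z1 hf) mulr1 -[d]mul1n small//= => /esym/eqP.
by rewrite (negPf v0).
Qed.

(** [U f] is a chain of [pi'], hence made of combinations of the [f' n]; this
    compares the periods, in both directions.  A nonzero coefficient of [U f 0]
    then aligns the letters, and following it along one period compares the
    phases. *)
Lemma pchain_equiv (pi pi' : representation O) (h h' : nat -> 'I_N) k k' (z z' : R[i])
    (f : nat -> pi) (f' : nat -> pi') :
  (forall n, A (h n) (h n.+1)) -> (forall n, A (h' n) (h' n.+1)) ->
  (0 < k)%N -> (0 < k')%N -> `|z| = 1 -> `|z'| = 1 ->
  periodic_chain s h k z f -> periodic_chain s h' k' z' f' -> unitary_equiv pi pi' ->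
  [/\ k = k', z = z' & exists2 r, (r < k)%N & forall n, h n = h' (n + r)%N].
Proof.
move=> hA hA' k0 k'0 z1 z'1 hf hf' eqv.
have transport (rho rho' : representation O) (g : nat -> 'I_N) l (u : R[i]) (y : nat -> rho) :
    periodic_chain s g l u y -> unitary_equiv rho rho' -> exists y' : nat -> rho',
    [/\ chain s g y', forall n, y' n = u *: y' (n + l)%N &
        forall i j : 'I_l, inner (y' i) (y' j) = (i == j)%:R].
  move=> [ch per orth _] [U [Ui Us Ua]]; exists (fun n => U (y n)); split.
  - by move=> n; rewrite -Ua ch.
  - by move=> n; rewrite -linearZ -per.
  - by move=> i j; rewrite Ui.
have [y [ych yper yorth]] := transport _ _ _ _ _ _ hf eqv.
have [x [xch xper xorth]] := transport _ _ _ _ _ _ hf' (unitary_equiv_sym eqv).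
have [kk' [r [rk' yr]]] := chain_comparison ck gen hA' k'0 z'1 hf' hA ych k0 z1 yper yorth.
have [k'k _] := chain_comparison ck gen hA k0 z1 hf hA' xch k'0 z'1 xper xorth.
have kE : k = k' by apply/eqP; rewrite eqn_leq kk' k'k.
have ov := chain_overlap ck hA' hf' ych yr.
split=> //; last first.
  by exists r => [|n]; rewrite ?kE// addnC; have [] := ov n; rewrite add0n.
have [_ per' _ _] := hf'.
have e : inner (y 0) (f' r) = z * z'^* * inner (y 0) (f' r).
  rewrite {1}(yper 0) {1}(per' r) -kE innerZl innerZr mulrA.
  by congr (_ * _); have [_ <-] := ov k; rewrite add0n.
have zz' : z * z'^* = 1 by apply: (mulIf yr); rewrite mul1r -e.
have z'z' : z'^* * z' = 1 by rewrite mulrC -normCK z'1 expr1n.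
by rewrite -[z]mulr1 -z'z' mulrA zz' mul1r.
Qed.

End Equivalence.

(** * The direct sum over the roots of the phase *)

Lemma sum_root_powers (F : fieldType) (x : F) p :
  x ^+ p = 1 -> x != 1 -> \sum_(q < p) x ^+ q = 0.
Proof.
move=> xp x1; apply: (@mulfI _ (x - 1)); first by rewrite subr_eq0.
by rewrite mulr0 -subrX1 xp subrr.
Qed.

(** The first sums are geometric, with ratio a [p]-th root of unity different from
    1 unless [i = j].  They give a right inverse of the Vandermonde matrix of the
    [u i]; this is also a left inverse, which is the second relation. *)
Lemma root_powers_orthogonal (F : fieldType) p (u : 'I_p -> F) (w : F) :
  p%:R != 0 :> F -> w != 0 -> injective u -> (forall i, u i ^+ p = w) ->
  (forall i j, \sum_(q < p) u i ^+ q * u j ^- q = p%:R * (i == j)%:R) /\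
  (forall q r : 'I_p, \sum_(i < p) u i ^- q * u i ^+ r = p%:R * (q == r)%:R).
Proof.
move=> p0 w0 uinj uw.
have u0 i : u i != 0.
  have pn0 : (p == 0)%N = false by apply: contraNF p0 => /eqP ->.
  apply/eqP => ui; move: (uw i); rewrite ui expr0n pn0 => /esym/eqP.
  by rewrite (negPf w0).
have rows i j : \sum_(q < p) u i ^+ q * u j ^- q = p%:R * (i == j)%:R.
  case: eqVneq => [->|ij].
    rewrite mulr1 -[RHS]mulr1 -[p in RHS]card_ord mulr_natl -sumr_const.
    by apply: eq_bigr => q _; rewrite mulfV// expf_neq0.
  rewrite mulr0; under eq_bigr do rewrite -exprVn -exprMn.
  apply: sum_root_powers; first by rewrite exprMn exprVn !uw mulfV.
  rewrite -subr_eq0 -(mulVf (u0 j)) mulrC -mulrBr mulf_eq0 invr_eq0.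
  by rewrite (negPf (u0 j)) subr_eq0 (inj_eq uinj).
split=> // q r.
pose V : 'M[F]_p := \matrix_(i, q) u i ^+ q.
pose V' : 'M[F]_p := \matrix_(q, j) (p%:R^-1 * u j ^- q).
have VV : V *m V' = 1%:M.
  apply/matrixP => i j; rewrite !mxE -[RHS](mulKf p0) -rows mulr_sumr.
  by apply: eq_bigr => l _; rewrite !mxE mulrCA.
have /matrixP/(_ q r) := mulmx1C VV; rewrite !mxE => <-.
rewrite mulr_sumr; apply: eq_bigr => i _.
by rewrite !mxE mulrA mulrA mulfV// mul1r.
Qed.

Section DirectSumChain.
Context (R : realType) (N : nat) (A : 'M[bool]_N) (O : cstarAlgType R).
Context (s : 'I_N -> O) (ck : ck_family A s).
Context (h : nat -> 'I_N) (hA : forall n, A (h n) (h n.+1)).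
Context (k p : nat) (u : 'I_p -> R[i]) (w : R[i]).
Context (k0 : (0 < k)%N) (p0 : (0 < p)%N) (uinj : injective u).
Context (u1 : forall i, `|u i| = 1) (uw : forall i, u i ^+ p = w).
Context (rho : 'I_p -> representation O) (f : forall i, nat -> rho i).
Context (hf : forall i, periodic_chain s h k (u i) (f i)).

Local Notation sigma := (direct_sum rho).

Let u0 i : u i != 0.
Proof. by rewrite -normr_eq0 u1 oner_eq0. Qed.

Let embed {i : 'I_p} (x : rho i) : sigma := dfwith (fun j => 0 : rho j) i x.

Let embed_lin i (c : R[i]) (x y : rho i) : embed (c *: x + y) = c *: embed x + embed y.
Proof.
apply/functional_extensionality_dep => j.
transitivity (c *: embed x j + embed y j); last by [].
rewrite /embed; case: dfwithP => [|j' ij]; first by rewrite !dfwithin.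
by rewrite !dfwithout// scaler0 addr0.
Qed.

Let embed_op i a (x : rho i) : rep_op a (embed x) = embed (rep_op a x).
Proof.
apply/functional_extensionality_dep => j.
transitivity (rep_op a (embed x j)); first by [].
rewrite /embed; case: dfwithP => [|j' ij]; first by rewrite !dfwithin.
by rewrite !dfwithout// op_0.
Qed.

Let embed_norm i (x : rho i) : `|embed x| <= `|x|.
Proof.
apply: le_trans (hsum_le_proj _) _.
rewrite (bigD1 i)//= big1 => [|j ji]; first by rewrite addr0 /embed dfwithin.
by rewrite /embed dfwithout ?normr0// eq_sym.
Qed.

Let embed_sum (x : sigma) : x = \sum_i embed (x i).
Proof.
apply/functional_extensionality_dep => j.
have -> : (\sum_i embed (x i)) j = \sum_i embed (x i) j.
  by apply: (big_morph (fun y : sigma => y j)).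
rewrite (bigD1 j)//= big1 => [|i ij]; first by rewrite addr0 /embed dfwithin.
by rewrite /embed dfwithout.
Qed.

Let nc : R[i] := (sqrtC p%:R)^-1.

Let nc2 : p%:R * (nc * nc^*) = 1.
Proof.
have p0' : p%:R != 0 :> R[i] by rewrite pnatr_eq0 -lt0n.
have -> : nc^* = nc by rewrite (CrealP _)// ger0_real// invr_ge0 sqrtC_ge0.
by rewrite /nc -invfM -expr2 sqrtCK mulfV.
Qed.

Definition direct_sum_chain (n : nat) : sigma := fun i => nc *: f i n.

(** The vector built from the unit vectors of the summands is cyclic: the
    Vandermonde relation recovers each summand from the vectors of the chain whose
    index is a multiple of [k]. *)
Lemma direct_sum_periodic_chain : periodic_chain s h (p * k) w direct_sum_chain.
Proof.
have pR : p%:R != 0 :> R[i] by rewrite pnatr_eq0 -lt0n.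
have w0 : w != 0 by rewrite -(uw (Ordinal p0)) expf_neq0.
have [rows cols] := root_powers_orthogonal pR w0 uinj uw.
have ch : chain s h direct_sum_chain.
  move=> n; apply/functional_extensionality_dep => i.
  transitivity (rep_op (s (h n)) (nc *: f i n.+1)); first by [].
  by rewrite op_Z; have [-> _ _ _] := hf i.
split=> //.
- move=> n; apply/functional_extensionality_dep => i.
  transitivity (w *: (nc *: f i (n + p * k)%N)); last by [].
  rewrite (pchain_period k0 (u1 i) (hf i)) uw (scalerA nc) mulrC -scalerA scalerA.
  by rewrite mulfV// scale1r.
- move=> l m; have lk : (l %/ k < p)%N by rewrite ltn_divLR.
  have mk : (m %/ k < p)%N by rewrite ltn_divLR.
  transitivity (\sum_i inner (nc *: f i l) (nc *: f i m)); first by [].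
  transitivity ((l %% k == m %% k)%N%:R * (nc * nc^*) *
      \sum_i u i ^- (l %/ k) * u i ^+ (m %/ k)%N).
    rewrite mulr_sumr; apply: eq_bigr => i _.
    rewrite innerZl innerZr (pchain_inner k0 (u1 i) (hf i)).
    have -> : (u i ^- (m %/ k))^* = u i ^+ (m %/ k)%N.
      have := invC_norm (u i ^- (m %/ k)).
      by rewrite invrK normfV normrX u1 expr1n invr1 expr1n invr1 mul1r.
    ring.
  rewrite (cols (Ordinal lk) (Ordinal mk)) -val_eqE /=.
  rewrite (mulrC p%:R) mulrACA (mulrC (nc * _) p%:R) nc2 mulr1 -natrM mulnb.
  congr (_%:R); congr nat_of_bool; apply/andP/eqP => [[/eqP r /eqP q]|->//].
  by apply: val_inj; rewrite /= (divn_eq l k) (divn_eq m k) r q.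
apply: full_cyclic_vector => K Kinv K0; have [K00 Kl Kc Ki] := Kinv.
have Ksub : subspace K by [].
have Kn n : K (direct_sum_chain n).
  have := chain_word_adj ck hA ch (segment h 0 n) 0.
  by rewrite size_map size_iota eqxx scale1r add0n => <-; exact: Ki.
have embed0 j : embed (0 : rho j) = 0.
  by apply/functional_extensionality_dep => i; rewrite /embed; case: dfwithP.
have Kj j : [set x : rho j | K (embed x)] = setT.
  have [_ _ _ cyc] := hf j; apply: (cyclic_vector_full cyc).
    split.
    - by rewrite /= embed0.
    - by move=> c x y Kx Ky; rewrite /= embed_lin; exact: Kl.
    - apply: closed_approx => x Kx; apply: (closed_mem Kc) => e e0.
      have [y Ky xy] := Kx e e0.
      exists (embed y) => //; apply: le_lt_trans xy.
      have -> : embed x - embed y = embed (x - y).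
        have -> : x - y = -1 *: y + x by rewrite scaleN1r addrC.
        by rewrite embed_lin scaleN1r addrC.
      exact: embed_norm.
    - by move=> a x Kx; rewrite /= -embed_op; exact: Ki.
  have nc0 : nc != 0.
    by apply/eqP => nc0; move/eqP: nc2; rewrite nc0 mul0r mulr0 eq_sym oner_eq0.
  have pnc0 : p%:R * nc != 0 by rewrite mulf_neq0.
  have sumE : \sum_(q < p) u j ^+ q *: direct_sum_chain (q * k) =
      (p%:R * nc) *: embed (f j 0).
    apply/functional_extensionality_dep => i.
    have -> : (\sum_(q < p) u j ^+ q *: direct_sum_chain (q * k)) i =
        \sum_(q < p) u j ^+ q *: (nc *: f i (q * k)%N).
      by apply: (big_morph (fun y : sigma => y i)).
    transitivity ((p%:R * nc) *: embed (f j 0) i); last by [].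
    transitivity ((nc * \sum_(q < p) u j ^+ q * u i ^- q) *: f i 0).
      rewrite mulr_sumr scaler_suml; apply: eq_bigr => q _.
      have /= := pchain_period k0 (u1 i) (hf i) q 0; rewrite add0n => ->.
      by rewrite !scalerA; congr (_ *: _); ring.
    rewrite rows /embed; case: dfwithP => [|i' ji].
      by rewrite eqxx mulr1 mulrC.
    by rewrite (negPf ji) !mulr0 scale0r scaler0.
  have -> : [set x : rho j | K (embed x)] (f j 0) = K (embed (f j 0)) by [].
  rewrite -[embed _]scale1r -(mulVf pnc0) -scalerA -sumE.
  by apply: subspaceZ => //; apply: subspace_sum => // q _; exact: subspaceZ.
apply/seteqP; split=> // x _; rewrite (embed_sum x); apply: subspace_sum => // i _.
by have : [set x : rho i | K (embed x)] (x i) by rewrite Kj.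
Qed.

End DirectSumChain.

(** * The root of unity and the theorem *)

Section RootOfUnity.
Context (R : realType) (p : nat) (p0 : (0 < p)%N).

Lemma expi2pi_divX n :
  expi2pi_div R p ^+ n = (cos (n%:R * (2 * pi / p%:R)) +i* sin (n%:R * (2 * pi / p%:R)))%C.
Proof.
elim: n => [|n IH]; first by rewrite !mul0r cos0 sin0.
rewrite exprSr IH /expi2pi_div; set t := 2 * pi / p%:R.
have -> : n.+1%:R * t = n%:R * t + t by rewrite -natr1 mulrDl mul1r.
rewrite cosD sinD; apply/eqP; rewrite eq_complex /= eqxx /=.
by rewrite addrC.
Qed.

(** If the order were some m < p, then cos (2 x) = 1 for x = m pi / p, so
    sin x = 0, which is impossible for 0 < x < pi. *)
Lemma expi2pi_div_prim : p.-primitive_root (expi2pi_div R p).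
Proof.
have pR : p%:R != 0 :> R by rewrite pnatr_eq0 -lt0n.
have pw : expi2pi_div R p ^+ p = 1.
  by rewrite expi2pi_divX mulrCA mulfV// mulr1 mulrC mulr_natr cos2pi sin2pi.
have [m mprim mp] := prim_order_exists p0 pw.
suff pm : p = m by rewrite {1}pm.
apply/eqP; rewrite eqn_leq [X in _ && X]dvdn_leq// andbT leqNgt; apply/negP => ltmp.
have m0 := prim_order_gt0 mprim.
have := prim_expr_order mprim; rewrite expi2pi_divX => /eqP.
rewrite eq_complex /= => /andP[/eqP c1 _].
pose x : R := m%:R * (pi / p%:R).
have xE : m%:R * (2 * pi / p%:R) = x *+ 2 by rewrite /x; ring.
have : sin x = 0.
  move: c1; rewrite xE mulr2n cosD -!expr2 => c1.
  by apply/eqP; rewrite -sqrf_eq0; apply/eqP; have := cos2Dsin2 x; lra.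
move/eqP; rewrite gt_eqF// sin_gt0_pi//.
rewrite /x mulr_gt0 ?divr_gt0 ?pi_gt0 ?ltr0n//=.
by rewrite mulrCA gtr_pMr ?pi_gt0// ltr_pdivrMr ?ltr0n// mul1r ltr_nat.
Qed.

Lemma expi2pi_div_norm : `|expi2pi_div R p| = 1.
Proof.
apply/eqP; rewrite -(@eqrXn2 _ p)//.
by rewrite -normrX (prim_expr_order expi2pi_div_prim) normr1 expr1n.
Qed.

End RootOfUnity.

Theorem corollary5p2 (R : realType) (N : nat) (A : 'M[bool]_N)
    (OA : cstarAlgType R) (s : 'I_N -> OA)
    (hN : (2 <= N)%N) (hA : no_zero_row_col A) (hO : is_cuntz_krieger A s) :
  [/\ (forall (J : seq 'I_N) (z : R[i]), cyclic_word A J -> `|z| = 1 ->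
         forall pi : representation OA, is_P s J z pi ->
           (irreducible_rep pi <-> ~ periodic_word J)) /\
      (forall J : seq 'I_N, cyclic_word A J ->
         forall pi : representation OA, is_P s J 1 pi ->
           (irreducible_rep pi <-> ~ periodic_word J)),
      forall (J J' : seq 'I_N) (z z' : R[i]),
        cyclic_word A J -> cyclic_word A J' -> `|z| = 1 -> `|z'| = 1 ->
        forall pi pi' : representation OA, is_P s J z pi -> is_P s J' z' pi' ->
          (unitary_equiv pi pi' <-> word_rotation J J' /\ z = z')
    & forall (J : seq 'I_N) (w : R[i]) (p : nat) (v : R[i]),
        cyclic_word A J -> `|w| = 1 -> (1 <= p)%N -> v ^+ p = w ->
        forall (pi : representation OA) (rho : 'I_p -> representation OA),
          is_P s (word_pow J p) w pi ->
          (forall j : 'I_p, is_P s J (v * expi2pi_div R p ^+ j.+1) (rho j)) ->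
          unitary_equiv pi (direct_sum rho) /\
          (~ periodic_word J -> multiplicity_free rho)].
Proof.
have [ck gen _] := hO; pose i0 : 'I_N := Ordinal (ltnW hN).
have sz J : cyclic_word A J -> (0 < size J)%N by case; rewrite lt0n size_eq0.
have nz (z : R[i]) : `|z| = 1 -> z != 0 by move=> z1; rewrite -normr_eq0 z1 oner_eq0.
have irr J (z : R[i]) : cyclic_word A J -> `|z| = 1 ->
    forall pi : representation OA, is_P s J z pi ->
    (irreducible_rep pi <-> ~ periodic_word J).
  move=> cJ z1 pi PJ; have hJ := cyclic_word_periodize i0 cJ.
  have [f hf] := is_P_periodic_chain i0 cJ.1 (nz z z1) PJ.
  split=> [ir [J0 [m [J00 m2 JE]]]|aper].
    apply: (@periodic_reducible _ _ A _ s ck gen pi (periodize i0 J) (size J0) m z f) => //.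
      by move=> n; rewrite JE !periodize_word_pow ?periodizeD// ltnW.
    by rewrite -size_word_pow -JE.
  apply: (aperiodic_irreducible ck gen hJ (sz J cJ) z1 hf) => l.
  exact: aperiodic_segment.
have equiv (J J' : seq 'I_N) (z z' : R[i]) :
    cyclic_word A J -> cyclic_word A J' -> `|z| = 1 -> `|z'| = 1 ->
    forall pi pi' : representation OA, is_P s J z pi -> is_P s J' z' pi' ->
    (unitary_equiv pi pi' <-> word_rotation J J' /\ z = z').
  move=> cJ cJ' z1 z'1 pi pi' PJ PJ'.
  have hJ := cyclic_word_periodize i0 cJ; have hJ' := cyclic_word_periodize i0 cJ'.
  have [f hf] := is_P_periodic_chain i0 cJ.1 (nz z z1) PJ.
  have [f' hf'] := is_P_periodic_chain i0 cJ'.1 (nz z' z'1) PJ'.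
  split=> [eqv|[/(word_rotationP i0) [sJ [r rJ hr]] zz']].
    have [sJ -> [r rJ hr]] :=
      pchain_equiv ck gen hJ' hJ (sz J' cJ') (sz J cJ) z'1 z1 hf' hf (unitary_equiv_sym eqv).
    split=> //; apply/(word_rotationP i0); split=> //; exists r => //.
    by rewrite -sJ ltnW.
  (* Rotating the word by r is shifting the chain by r. *)
  have := pchain_shift (sz J cJ) z1 hf r; rewrite -(funext hr) sJ zz' => hf1.
  have [U [Ui Us Ua _]] := pchain_unitary ck gen hJ' (sz J' cJ') z'1 hf1 hf'.
  by exists U.
split=> //; first by split=> // J cJ; apply: irr => //; exact: normr1.
move=> J w p v cJ w1 p0 vw pi rho Ppi Prho.
have v1 : `|v| = 1.
  by apply/eqP; rewrite -(@eqrXn2 _ p)// -normrX vw w1 expr1n.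
have prim := expi2pi_div_prim R p0.
pose u (j : 'I_p) : R[i] := v * expi2pi_div R p ^+ j.+1.
have u1 j : `|u j| = 1 by rewrite normrM normrX expi2pi_div_norm// expr1n v1 mulr1.
have uw j : u j ^+ p = w.
  by rewrite exprMn vw exprAC (prim_expr_order prim) expr1n mulr1.
have uinj : injective u.
  move=> i j /(mulfI (nz v v1)) /eqP; rewrite (eq_prim_root_expr prim).
  rewrite -(addn1 i) -(addn1 j) eqn_modDr !modn_small// => /eqP ij.
  exact: val_inj.
split; last first.
  move=> aper; split=> [i|i j ij eqv]; first exact: (irr J (u i) cJ (u1 i) (rho i) (Prho i)).2 aper.
  have [_ /uinj e] := (equiv J J (u i) (u j) cJ cJ (u1 i) (u1 j) _ _ (Prho i) (Prho j)).1 eqv.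
  by rewrite e eqxx in ij.
have hJ := cyclic_word_periodize i0 cJ.
pose chain_of i := cid (is_P_periodic_chain i0 cJ.1 (nz _ (u1 i)) (Prho i)).
have hf i : periodic_chain s (periodize i0 J) (size J) (u i)
    (sval (chain_of i)) := svalP (chain_of i).
have J0 : word_pow J p != [::].
  by rewrite -size_eq0 size_word_pow -lt0n muln_gt0 p0 sz.
have [g hg] := is_P_periodic_chain i0 J0 (nz w w1) Ppi.
have hg1 : periodic_chain s (periodize i0 J) (p * size J) w g.
  rewrite -size_word_pow; have <- // : periodize i0 (word_pow J p) = periodize i0 J.
  by apply/funext => n; apply: periodize_word_pow => //; exact: sz.
have hsum := direct_sum_periodic_chain ck hJ (sz J cJ) p0 uinj u1 uw hf.
have pk0 : (0 < p * size J)%N by rewrite muln_gt0 p0 sz.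
have [U [Ui Us Ua _]] := pchain_unitary ck gen hJ pk0 w1 hg1 hsum.
by exists U.
Qed.
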